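(* Let $I$ be an interval on the real line, let $\psi : I \to \mathbb{R}$ be a continuous function and let $\mathcal{C}>0$ be a parameter such that the following two conditions hold: for all real numbers $\delta_1,\delta_2$ with $\delta_1 \neq 0$, $$|\{(x,y)\in I^2 : x-y=\delta_1,\ \psi(x)-\psi(y)=\delta_2\}| \ll_{\mathcal{C}} 1,$$ and for all real numbers $n_1,n_2$, $$|\{(x,y)\in I^2 : x+y=n_1,\ \psi(x)+\psi(y)=n_2\}| \ll_{\mathcal{C}} 1.$$ Let $A$ be a finite, non-empty subset of $I$, and let $s \geq 3$ be a natural number. Then $$E_{s,2}(A) \ll_{\mathcal{C}} |A|^{2s-3+2^{-s+2}}.$$
   Context: $E_{s,2}(A)$ denotes the number of $(x_1,\dots,x_{2s}) \in A^{2s}$ satisfying $\sum_{i=1}^{s}(\psi(x_i)-\psi(x_{i+s})) = \sum_{i=1}^{s}(x_i-x_{i+s}) = 0$. The notation $X \ll_{\mathcal{C}} Y$ means $|X| \leq K|Y|$ for some constant $K>0$ depending only on $\mathcal{C}$ (after renaming the parameter, the two conditions on $I,\psi$ say that the stated cardinalities are at most $\mathcal{C}$). *)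

(* Defs.v *)
From HB Require Import structures.
From mathcomp Require Import all_boot all_order all_algebra finmap.
From mathcomp Require Import all_classical all_reals all_analysis.

Set Implicit Arguments.
Unset Strict Implicit.
Unset Printing Implicit Defensive.

Import Order.TTheory GRing.Theory Num.Theory.
Import numFieldNormedType.Exports.

Local Open Scope classical_set_scope.
Local Open Scope ring_scope.

(* The finiteness clause is needed: [fset_set S] is empty when S is infinite. *)
Definition card_at_most (R : realType) (T : choiceType) (S : set T) (c : R) : Prop :=
  finite_set S /\ (#|` fset_set S|)%:R <= c.

Definition diff_solutions (R : realType) (I : interval R) (psi : R -> R)
    (d1 d2 : R) : set (R * R) :=
  [set p | [/\ p.1 \in I, p.2 \in I, p.1 - p.2 = d1 & psi p.1 - psi p.2 = d2]].

Definition sum_solutions (R : realType) (I : interval R) (psi : R -> R)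
    (n1 n2 : R) : set (R * R) :=
  [set p | [/\ p.1 \in I, p.2 \in I, p.1 + p.2 = n1 & psi p.1 + psi p.2 = n2]].

(* E_{s,2}(A); the variables x_i and x_{i+s} (1 <= i <= s) are
   [x (lshift s i)] and [x (rshift s i)] for i : 'I_s. *)
Definition energy (R : realType) (psi : R -> R) (s : nat) (A : {fset R}) : nat :=
  #|[set x : {ffun 'I_(s + s) -> A} |
      (\sum_(i < s) (psi (val (x (lshift s i))) - psi (val (x (rshift s i)))) == 0)
      && (\sum_(i < s) (val (x (lshift s i)) - val (x (rshift s i))) == 0)]%SET|.

(* Main.v *)
Require Import Defs.
From HB Require Import structures.
From Stdlib Require Import Btauto.
From mathcomp Require Import all_boot all_order all_algebra finmap.
From mathcomp Require Import all_classical all_reals all_analysis.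
From mathcomp Require Import zify ring lra.
From mathcomp Require Import fintype finset.

Set Implicit Arguments.
Unset Strict Implicit.
Unset Printing Implicit Defensive.

Import Order.TTheory GRing.Theory Num.Theory.
Import numFieldNormedType.Exports.

(** Write N for the size of A, Gamma for the graph of psi over A and r_s(n) for
    the number of ways to write a point n of the plane as a sum of s points of
    Gamma.  Then E_{s,2}(A) is the second moment M_s = sum_n r_s(n)^2, and
      r_{s+1}(n) = sum of r_s(m) over the points m that lie on n - Gamma,
    so that r_{s+1} counts incidences, weighted by r_s, between points and
    reflected translates of the graph.  By the condition on differences, two such
    translates meet boundedly often and two points lie on boundedly many of them;
    this is the setting of the Szemeredi-Trotter theorem ([szemeredi_trotter]).
    A weighted form of it ([card_rich]) bounds the number of n with
    r_{s+1}(n) >= tau by a multiple of N^s (M_s / tau^3 + 1 / tau) as soon as tau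
    is at least twice the maximum of r_s.  Summing over tau > k0, and using
    sum_n r_{s+1}(n) = N^{s+1} below k0, gives ([second_moment_recursion])
      M_{s+1} << k0 N^{s+1} + N^s M_s / k0 + N^{2s-1},
    and k0 close to (M_s / N)^{1/2} yields M_{s+1} << N^{s+1/2} M_s^{1/2}.
    If M_s <= K N^{2s-3+eta}, this reads M_{s+1} << K^{1/2} N^{2(s+1)-3+eta/2}:
    the excess eta is halved at each step, and as the constant enters only through
    its square root, one K serves for every s ([second_moment_bound]).  The start
    M_2 << N^2, that is eta = 1, is the condition on sums.

    The incidence theorem follows the crossing-number method of Szekely: join
    consecutive points on each curve by the arc between them, and compare a linear
    bound for the number of edges of a drawing without crossings with the number
    of crossings, after passing to a random set of vertices.  The function psi is
    merely continuous, so two arcs that share an endpoint may cross again, and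
    such pairs are too numerous to be discarded.  The linear bound used here
    therefore ignores them: it holds for graphs drawn so that edges without a
    common endpoint cross an even number of times ([even_drawing_sparse]).  For
    arcs that are graphs of functions, the parity of the crossings of two edges
    can be read off from which endpoint lies above which edge
    ([crossing_parity]).  Summed over the 15 disjoint pairs of edges of K5 these
    parities give 1, so K5 has no even drawing ([K5_not_even]); even drawings
    survive the contraction of an edge ([even_drawing_contract]); and a graph of
    average degree at least 15 contracts to K5 ([dense_minor]). *)

(** * Parity of crossings and the graph K5 *)

Lemma addb_xorb : addb =2 xorb. Proof. by do 2!case. Qed.

(** The vertices are ordered by [before], from left to right, and [s u w x] says
    that x lies above the edge uw.  If uw and xy are x-monotone arcs, moving along
    their common range shows that the number of their crossings has this parity:
    x and y are compared with uw when they lie over it, u and w with xy, and the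
    terms in [before] correct for interleaved endpoints, where an arc without
    crossings has one endpoint above and one below the other arc.  The formula is
    additive in the two edges, and this is what makes contraction possible. *)
Definition crossing_parity (T : finType) (before : rel T) (s : T -> T -> T -> bool) (u w x y : T) :=
  (s u w x (+) s u w y) (+) (s x y u (+) s x y w) (+)
  ((before u x (+) before u y) (+) (before w x (+) before w y)).

(** No geometry is left here: after contractions [s u w] is a formal sum of side
    functions of the edges along a path from u to w, and no longer describes an
    arc.  Pairs of edges with a common endpoint are not constrained. *)
Definition even_drawing (T : finType) (before : rel T) (S : {set T}) (e : rel T)
    (s : T -> T -> T -> bool) :=
  (forall u w x, s u w x = s w u x) /\
  forall u w x y, [/\ u \in S, w \in S, x \in S & y \in S] ->
    uniq [:: u; w; x; y] -> e u w -> e x y -> crossing_parity before s u w x y = false.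

Definition strict_total (T : finType) (before : rel T) :=
  forall u v, u != v -> before v u = ~~ before u v.

(** Add the parities of all 15 pairs of disjoint edges.  The term [s u w x] occurs
    in the two pairs that consist of uw and an edge from x avoiding u and w, hence
    cancels.  The comparisons of two vertices leave the number of interleaved
    pairs, which is odd: each four of the five vertices span exactly one. *)
Lemma K5_not_even (T : finType) (before : rel T) (S : {set T}) (e : rel T) s a b c d f :
  strict_total before -> even_drawing before S e s ->
  uniq [:: a; b; c; d; f] -> {subset [:: a; b; c; d; f] <= S} ->
  (forall u v, u \in [:: a; b; c; d; f] -> v \in [:: a; b; c; d; f] -> u != v -> e u v) ->
  False.
Proof.
move=> tot [sC ev] U sub adj.
have H u w x y : uniq [:: u; w; x; y] -> {subset [:: u; w; x; y] <= [:: a; b; c; d; f]} ->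
    crossing_parity before s u w x y = false.
  move=> U4 sub4; apply: ev => //.
  - by split; apply: sub; apply: sub4; rewrite !inE eqxx ?orbT.
  - apply: adj; try (by apply: sub4; rewrite !inE eqxx ?orbT).
    by move: U4; rewrite /= !inE !negb_or -!andbA => /andP[].
  apply: adj; try (by apply: sub4; rewrite !inE eqxx ?orbT).
  by move: U4; rewrite /= !inE !negb_or -!andbA; do 5!case/andP=> ?; move/andP=> [].
have K i j k l : all (fun h => h < 5) [:: i; j; k; l] -> uniq [:: i; j; k; l] ->
    let v := nth a [:: a; b; c; d; f] in crossing_parity before s (v i) (v j) (v k) (v l) = false.
  move=> /allP lt5 U4 v; have E : [:: v i; v j; v k; v l] = map v [:: i; j; k; l] by [].
  apply: H; rewrite E.
    by rewrite map_inj_in_uniq // => p q /lt5 hp /lt5 hq /eqP; rewrite /v nth_uniq // => /eqP.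
  by move=> z /mapP[p /lt5 hp ->]; rewrite /v mem_nth.
have parities := (K 0 1 2 3 isT isT, K 0 1 2 4 isT isT, K 0 1 3 4 isT isT,
  K 0 2 1 3 isT isT, K 0 2 1 4 isT isT, K 0 2 3 4 isT isT,
  K 0 3 1 2 isT isT, K 0 3 1 4 isT isT, K 0 3 2 4 isT isT,
  K 0 4 1 2 isT isT, K 0 4 1 3 isT isT, K 0 4 2 3 isT isT,
  K 1 2 3 4 isT isT, K 1 3 2 4 isT isT, (K 1 4 2 3 isT isT)).
pose cp := crossing_parity before s.
have : foldr addb false [:: cp a b c d; cp a b c f; cp a b d f; cp a c b d; cp a c b f;
  cp a c d f; cp a d b c; cp a d b f; cp a d c f; cp a f b c; cp a f b d; cp a f c d;
  cp b c d f; cp b d c f; cp b f c d] = false by rewrite /cp /= !parities.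
move: U; rewrite /= !inE !negb_or -!andbA.
move=> /and5P[_ _ _ _ /and5P[bc bd bf cd /andP[cf /andP[df _]]]].
rewrite /cp /crossing_parity /= (tot _ _ bc) (tot _ _ bd) (tot _ _ bf) (tot _ _ cd) (tot _ _ cf) (tot _ _ df) !addb_xorb.
set total := xorb _ _; suff -> : total = true by [].
by rewrite /total; btauto.
Qed.

(** * Sparsity of evenly drawn graphs *)

Lemma crossing_parity_sym (T : finType) (before : rel T) s u w x y : strict_total before ->
  uniq [:: u; w; x; y] ->
  crossing_parity before s u w x y = crossing_parity before s x y u w.
Proof.
move=> tot; rewrite /= !inE !negb_or -!andbA => /and5P[_ ux uy wx /andP[wy _]].
rewrite /crossing_parity (tot _ _ ux) (tot _ _ uy) (tot _ _ wx) (tot _ _ wy).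
rewrite (addbC (s u w x (+) _)); congr (_ (+) _).
by do 4!case: (before _ _).
Qed.

Lemma crossing_parity_flip (T : finType) (before : rel T) s u w x y : (forall u w x, s u w x = s w u x) ->
  crossing_parity before s u w x y = crossing_parity before s w u x y.
Proof.
move=> sC; rewrite /crossing_parity !(sC w u) (addbC (s x y w)).
by rewrite (addbC (before w x (+) _)).
Qed.

Definition contract (T : eqType) (p q : T) (e : rel T) : rel T :=
  fun u w => (u != w) && [|| e u w, (u == p) && e q w | (w == p) && e u q].

Lemma contract_sym (T : eqType) (p q : T) e : symmetric e -> symmetric (contract p q e).
Proof.
move=> eC u w; rewrite /contract eq_sym eC; congr (_ && (_ || _)).
by rewrite orbC (eC u q) (eC q w).
Qed.

Lemma contract_irr (T : eqType) (p q : T) e : irreflexive (contract p q e).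
Proof. by move=> u; rewrite /contract eqxx. Qed.

(** An edge from q to w becomes an edge from p to w, drawn as the path p, q, w: its
    side function is the sum of those of pq and qw.  Against a disjoint edge xy,
    the parities of pq and qw add up to that of the new edge, because the terms
    about q occur twice. *)
Lemma even_drawing_contract (T : finType) (before : rel T) (S : {set T}) (e : rel T) s p q :
  strict_total before -> symmetric e -> p \in S -> q \in S -> p != q -> e p q ->
  even_drawing before S e s ->
  exists s', even_drawing before (S :\ q) (contract p q e) s'.
Proof.
move=> tot eC pS qS npq epq [sC ev].
pose s' u w x := if e u w then s u w x else
  if u == p then s p q x (+) s q w x else if w == p then s p q x (+) s q u x else s u w x.
have s'C u w x : s' u w x = s' w u x.
  rewrite /s' eC sC; case: ifP => // _.
  by case: (u =P p) => [up|_]; case: (w =P p) => [wp|_]; rewrite ?up ?wp.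
exists s'; split=> //.
(* the new edge pw is drawn as the path p, q, w *)
have routed w x y : w \in S -> x \in S -> y \in S -> uniq [:: p; w; x; y] -> w != q -> x != q -> y != q ->
    e p w = false -> e q w -> e x y -> crossing_parity before s' p w x y = false.
  move=> wS xS yS U wq xq yq epw eqw exy.
  have := U; rewrite /= !inE !negb_or -!andbA => /and5P[pw px py wx /andP[wy /andP[xy _]]].
  have := ev p q x y; rewrite pS qS xS yS /= !inE !negb_or npq px py xy /= !(eq_sym q) xq yq.
  move=> /(_ _ isT epq exy) E1.
  have := ev q w x y; rewrite qS wS xS yS /= !inE !negb_or !(eq_sym q) wq xq yq wx wy xy.
  move=> /(_ _ isT eqw exy) E2.
  have E : crossing_parity before s p q x y (+) crossing_parity before s q w x y = false.
    by rewrite E1 ?E2.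
  rewrite -[RHS]E /crossing_parity /s' epw exy eqxx !addb_xorb.
  btauto.
have one u w x y : [/\ u \in S, w \in S, x \in S & y \in S] ->
    [/\ u != q, w != q, x != q & y != q] -> uniq [:: u; w; x; y] ->
    contract p q e u w -> e x y -> crossing_parity before s' u w x y = false.
  move=> [uS wS xS yS] [uq wq xq yq] U /andP[uw] euw exy.
  have [E|E] := boolP (e u w).
    by rewrite -[RHS](ev u w x y) // /crossing_parity /s' E exy.
  move: euw; rewrite (negbTE E) /= => /orP[] /andP[/eqP up eq]; subst.
    by apply: routed => //; apply: negbTE.
  rewrite crossing_parity_flip //; apply: routed => //; last by rewrite eC.
    by rewrite (@perm_uniq _ _ [:: u; p; x; y]) // (perm_catCA [:: p] [:: u]).
  by rewrite eC; apply: negbTE.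
move=> u w x y; rewrite !inE => -[/andP[uq uS] /andP[wq wS] /andP[xq xS] /andP[yq yS]] U cuw cxy.
have [E|E] := boolP (e x y); first by apply: one.
have [E'|E'] := boolP (e u w).
  rewrite crossing_parity_sym //; apply: one => //.
  by move: U; rewrite -[_ :: _]/([:: u; w] ++ [:: x; y]) uniq_catC.
(* both edges are new: then both contain p, and they are not disjoint *)
move: cuw cxy; rewrite /contract (negbTE E) (negbTE E') /= => /andP[_ /orP[]/andP[/eqP up _]] /andP[_ /orP[]/andP[/eqP xp _]];
by move: U; rewrite up xp /= !inE eqxx ?orbT ?andbF.
Qed.

Definition degree (T : finType) (S : {set T}) (e : rel T) (u : T) := #|[set w in S | e u w]|.

(** Contracting pq removes the edge pq and identifies two edges for each common
    neighbour of p and q; each loss counts twice in the sum of the degrees. *)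
Lemma degree_sum_contract (T : finType) (S : {set T}) (e : rel T) p q :
  symmetric e -> irreflexive e -> p \in S -> q \in S -> e p q ->
  \sum_(u in S) degree S e u <=
  \sum_(u in S :\ q) degree (S :\ q) (contract p q e) u + 2
    + 2 * #|[set w in S | e p w & e q w]|.
Proof.
move=> eC eI pS qS epq.
have npq : p != q by apply: contraTneq epq => ->; rewrite eI.
have pSq : p \in S :\ q by rewrite !inE npq.
rewrite (big_setD1 q qS) (big_setD1 p pSq) (big_setD1 p pSq) /=.
set com := #|_|.
have far u : u \in S :\ q :\ p ->
    degree S e u <= degree (S :\ q) (contract p q e) u + (e u p && e u q).
  rewrite !inE => /and3P[up uq uS].
  rewrite /degree (cardsD1 q) inE qS /=.
  set A := _ :\ q; set B := [set w in _ | _].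
  have AB : A \subset B.
    apply/subsetP => w; rewrite !inE => /and3P[-> -> euw].
    by rewrite /contract euw /= andbT; apply: contraTneq euw => ->; rewrite eI.
  case: (boolP (e u q)) => euq; last by rewrite andbF addn0 add0n subset_leq_card.
  case: (boolP (e u p)) => eup /=; first by rewrite addnC leq_add2r subset_leq_card.
  have pA : p \notin A by rewrite !inE (negbTE eup) !andbF.
  rewrite addn0 -[X in X <= _]/(true + #|A|) -pA -cardsU1 subset_leq_card // subUset AB andbT.
  by rewrite sub1set !inE npq pS /contract up euq eqxx !orbT.
have near : degree S e q + degree S e p <= degree (S :\ q) (contract p q e) p + 2 + com.
  rewrite /degree addnC -cardsUI; apply: leq_add; last first.
    by apply: subset_leq_card; apply/subsetP => w; rewrite !inE -!andbA => /and4P[-> -> _ ->].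
  rewrite addnC -[2]/(1 + 1) -addnA.
  set B := [set w in _ | contract _ _ _ _ _].
  apply: (@leq_trans #|p |: (q |: B)|).
    apply: subset_leq_card; apply/subsetP => w; rewrite !inE /contract eqxx /=.
    case: (eqVneq w p) => //= wp; case: (eqVneq w q) => //= wq.
    by case: (w \in S); case: (e p w); case: (e q w).
  by rewrite cardsU1 leq_add ?leq_b1 // cardsU1 leq_add2r leq_b1.
have sumcom : \sum_(u in S :\ q :\ p) (e u p && e u q : nat) <= com.
  rewrite -big_mkcondr /= sum1_card; apply: subset_leq_card; apply/subsetP => w.
  by rewrite !inE unfold_in /= !inE (eC p) (eC q) => /andP[/and3P[_ _ ->] ->].
have := leq_sum (index_enum T) far; rewrite big_split /= => far'.
lia.
Qed.

(** The graph [e] with an apex p joined to everything. *)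
Definition cone (T : eqType) (p : T) (e : rel T) : rel T :=
  fun u w => (u != w) && [|| u == p, w == p | e u w].

(** A graph whose average degree is at least 2 ^ r - 1 has K_(r+1) as a minor;
    minors are spoken of through a class Q that is closed under induced subgraphs
    and contractions.  Contract edges as long as the density bound survives.  When
    it fails for every edge, adjacent vertices have many common neighbours, so the
    neighbourhood of a vertex p is again dense, with half the density.  Induction
    on r applies to it and to the class of the graphs whose cone with apex p is in
    Q, and p completes the minor found there. *)
Lemma dense_minor (T : finType) r (Q : {set T} -> rel T -> Prop) :
  (forall (S : {set T}) (e e' : rel T), {in S &, e =2 e'} -> Q S e -> Q S e') ->
  (forall (S S' : {set T}) e, S' \subset S -> Q S e -> Q S' e) ->
  (forall (S : {set T}) e p q, symmetric e -> irreflexive e -> p \in S -> q \in S -> e p q -> Q S e ->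
     Q (S :\ q) (contract p q e)) ->
  forall S e, symmetric e -> irreflexive e -> Q S e -> S != set0 ->
  (2 ^ r).-1 * #|S| <= \sum_(u in S) degree S e u ->
  exists S' e', [/\ Q S' e', #|S'| = r.+1 & {in S' &, forall u w, u != w -> e' u w}].
Proof.
elim: r Q => [|r IHr] Q Qext Qsub Qcon S e.
  move=> _ _ QS /set0Pn[u uS] _; exists [set u], e; split; first by apply: Qsub QS; rewrite sub1set.
    by rewrite cards1.
  by move=> v w /set1P-> /set1P->; rewrite eqxx.
have [n] := ubnP #|S|; elim: n S e => // n IHn S e ltSn eC eI QS S0 dense.
set c := (2 ^ r).-1 in IHr; have cS : (2 ^ r.+1).-1 = 2 * c + 1.
  by rewrite /c expnS; have := expn_gt0 2 r; lia.
rewrite cS in dense IHn.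
pose shrinks p q := (2 * c + 1) * #|S :\ q| <= \sum_(u in S :\ q) degree (S :\ q) (contract p q e) u.
have [/existsP[p /existsP[q /and4P[pS qS epq hpq]]]|] :=
  boolP [exists p, exists q, [&& p \in S, q \in S, e p q & shrinks p q]].
  apply: (IHn _ _ _ (contract_sym _ _ eC) (contract_irr _ _ e) _ _ hpq); last 1 first.
  - apply/set0Pn; exists p; rewrite !inE pS andbT.
    by apply: contraTneq epq => ->; rewrite eI.
  - by move: ltSn; rewrite (cardsD1 q) qS; lia.
  exact: Qcon.
(* no contraction keeps the density, so adjacent vertices have many common neighbours *)
rewrite negb_exists => /forallP noshrink.
have common p q : p \in S -> q \in S -> e p q -> c <= #|[set w in S | e p w & e q w]|.
  move=> pS qS epq; have := noshrink p; rewrite negb_exists => /forallP/(_ q).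
  rewrite pS qS epq /= -ltnNge => lt.
  have := degree_sum_contract eC eI pS qS epq.
  move: dense; rewrite (cardsD1 q) qS; lia.
have [p pS degp] : exists2 p, p \in S & 0 < degree S e p.
  apply/exists_inP; apply: contraLR dense; rewrite negb_exists => /forallP h.
  rewrite big1 ?muln_gt0 -?ltnNge ?muln_gt0 ?card_gt0 ?S0 ?addn1 // => u uS.
  by have := h u; rewrite uS /= -eqn0Ngt => /eqP.
pose N := [set w in S | e p w].
pose Q' (S' : {set T}) (e' : rel T) := p \notin S' /\ Q (p |: S') (cone p e').
have [S1 [e1 [[pS1 QS1] card1 comp]]] : exists S' e',
    [/\ Q' S' e', #|S'| = r.+1 & {in S' &, forall u w, u != w -> e' u w}].
  apply: (IHr Q' _ _ _ N e eC eI).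
  - move=> S1 e1 e2 eqe [pS1 QS1]; split=> //; apply: Qext QS1 => u v uS vS.
    rewrite /cone; case: eqVneq => //= uv; case: (eqVneq u p) => //= up; case: (eqVneq v p) => //= vp.
    by apply: eqe; [move: uS|move: vS]; rewrite !inE ?(negbTE up) ?(negbTE vp).
  - move=> S1 S2 e1 sub [pS1 QS1]; split; first by apply: contra pS1 => /(subsetP sub).
    by apply: Qsub QS1; apply: setUS.
  - move=> S1 e1 u v e1C e1I uS1 vS1 e1uv [pS1 QS1].
    have pv : p != v by apply: contraNneq pS1 => ->.
    have pu : p != u by apply: contraNneq pS1 => ->.
    split; first by rewrite !inE negb_and pS1 orbT.
    have uv : u != v by apply: contraTneq e1uv => ->; rewrite e1I.
    have coneC : symmetric (cone p e1) by move=> a b; rewrite /cone eq_sym e1C orbCA.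
    have coneI : irreflexive (cone p e1) by move=> a; rewrite /cone eqxx.
    have := Qcon (p |: S1) (cone p e1) u v coneC coneI.
    rewrite !inE uS1 vS1 !orbT => /(_ isT isT _ QS1); rewrite {1}/cone uv e1uv !orbT => /(_ isT).
    have -> : (p |: S1) :\ v = p |: S1 :\ v.
      by apply/setP => a; rewrite !inE; case: eqVneq => //= ->; rewrite eq_sym (negbTE pv).
    apply: Qext => a b; rewrite !inE => aS bS; rewrite /contract /cone.
    case: (eqVneq a b) => //= ab.
    case: (eqVneq a p) => //= ap; case: (eqVneq b p) => //= bp.
    move: aS bS; rewrite (negbTE ap) (negbTE bp) /= => /andP[av _] /andP[bv _].
    by rewrite av (eq_sym v) bv (eq_sym v) (negbTE pv).
  - split; first by rewrite !inE eI andbF.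
    have : Q (p |: N) e.
      by apply: Qsub QS; rewrite subUset sub1set pS; apply/subsetP => w; rewrite inE => /andP[].
    apply: Qext => a b aN bN; rewrite /cone; case: (eqVneq a b) => [->|ab] /=; first exact: eI.
    case: (eqVneq a p) => [ap|ap] /=.
      by move: bN; rewrite !inE -ap eq_sym (negbTE ab) /= => /andP[_ ->].
    case: (eqVneq b p) => [bp|bp] //=.
    by move: aN; rewrite !inE (negbTE ap) bp eC /= => /andP[_ ->].
  - by rewrite -card_gt0.
  - rewrite mulnC -sum_nat_const; apply: leq_sum => w; rewrite inE => /andP[wS epw].
    apply: leq_trans (common p w pS wS epw) _.
    by apply: subset_leq_card; apply/subsetP => x; rewrite !inE => /and3P[-> -> ->].
exists (p |: S1), (cone p e1); split=> //; first by rewrite cardsU1 pS1 card1.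
move=> u w uS wS uw; rewrite /cone uw /=.
case: eqVneq => //= up; case: eqVneq => //= wp.
by apply: comp => //; [move: uS|move: wS]; rewrite !inE ?(negbTE up) ?(negbTE wp).
Qed.

(** The bound 15 is [2 ^ 4 - 1], the density that forces K5 as a minor.  Euler's
    formula would give average degree less than 6 for a planar graph, but would
    also demand that edges with a common endpoint do not cross. *)
Lemma even_drawing_sparse (T : finType) (before : rel T) (S : {set T}) (e : rel T) s :
  strict_total before -> symmetric e -> irreflexive e -> even_drawing before S e s ->
  \sum_(u in S) degree S e u <= 15 * #|S|.
Proof.
move=> tot eC eI ev; have [->|S0] := eqVneq S set0; first by rewrite big_set0.
rewrite leqNgt; apply/negP => dense.
pose Q (S : {set T}) (e : rel T) := exists s, even_drawing before S e s.
have [S1 [e1 [[s1 ev1] card1 comp]]] : exists S' e',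
    [/\ Q S' e', #|S'| = 5 & {in S' &, forall u w, u != w -> e' u w}].
  apply: (@dense_minor T 4 Q _ _ _ S e eC eI _ S0 (ltnW dense)).
  - move=> S1 e1 e2 eqe [s1 [s1C ev1]]; exists s1; split=> // u w x y [uS wS xS yS] U.
    by rewrite -!eqe // => *; apply: ev1.
  - move=> S1 S2 e1 sub [s1 [s1C ev1]]; exists s1; split=> // u w x y [uS wS xS yS].
    by apply: ev1; split; apply: (subsetP sub).
  - move=> S1 e1 p q e1C e1I pS qS e1pq [s1 ev1]; apply: even_drawing_contract ev1 => //.
    by apply: contraTneq e1pq => ->; rewrite e1I.
  - by exists s.
have : size (enum S1) = 5 by rewrite -cardE.
have memE : enum S1 =i S1 by move=> x; rewrite mem_enum.
have := enum_uniq S1.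
case: (enum S1) memE => [|a [|b [|c [|d [|f [|]]]]]] // memE U _.
apply: (K5_not_even tot ev1 U) => [x|u v]; rewrite !memE //.
by move=> uS vS; apply: comp.
Qed.

(** * The crossing inequality *)

(** A uniformly random map phi from V to k+1 colours vanishes on A with
    probability (k+1) ^ (- #|A|): the zero set of phi is a random subset that
    contains each vertex with probability 1 / (k+1), independently. *)
Lemma card_vanishing (V : finType) k (A : {set V}) :
  #|[set phi : {ffun V -> 'I_k.+1} | A \subset [set v | phi v == ord0]]| * k.+1 ^ #|A| = k.+1 ^ #|V|.
Proof.
have -> : #|[set phi : {ffun V -> 'I_k.+1} | A \subset [set v | phi v == ord0]]|
    = #|pffun_on (ord0 : 'I_k.+1) (~: A) (predT : {pred 'I_k.+1})|.
  apply: eq_card => phi; rewrite !inE; apply/idP/pffun_onP => [sub|[sub _]].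
    split=> //; apply/subsetP => v; rewrite !inE; apply: contra => /(subsetP sub).
    by rewrite inE.
  apply/subsetP => v vA; rewrite inE; apply: contraLR vA => nz.
  by have := subsetP sub v; rewrite !inE; apply.
by rewrite card_pffun_on card_ord -expnD addnC cardsC.
Qed.

Definition ends (V : finType) (e : V * V) : {set V} := [set e.1; e.2].

(** E is a set of oriented edges, and X contains every ordered pair of disjoint edges
    that cross an odd number of times. *)
Section Crossings.
Variables (V : finType) (before : rel V) (E : {set V * V}) (X : {set (V * V) * (V * V)}).
Variable s : V -> V -> V -> bool.
Hypothesis tot : strict_total before.
Hypothesis sC : forall u w x, s u w x = s w u x.
Hypothesis loopless : forall e, e \in E -> e.1 != e.2.
Hypothesis uncrossed : forall e f, e \in E -> f \in E -> uniq [:: e.1; e.2; f.1; f.2] ->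
  (e, f) \notin X -> crossing_parity before s e.1 e.2 f.1 f.2 = false.

(** Deleting one edge from every crossing pair inside S leaves an even drawing. *)
Lemma card_edges_within (S : {set V}) :
  #|[set e in E | ends e \subset S]| <=
  15 * #|S| + #|[set ef in X | ends ef.1 :|: ends ef.2 \subset S]|.
Proof.
set ES := [set e in E | _]; set XS := [set ef in X | _].
pose bad := [set ef.1 | ef in XS]; pose good := ES :\: bad.
have : #|ES| <= #|good| + #|XS|.
  rewrite -(cardsID bad ES) addnC leq_add2l.
  apply: leq_trans (leq_imset_card (fun ef => ef.1) XS).
  by apply: subset_leq_card; apply: subsetIr.
suff : #|good| <= 15 * #|S| by lia.
pose adj u w := ((u, w) \in good) || ((w, u) \in good).
have adjC : symmetric adj by move=> u w; rewrite /adj orbC.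
have adjI : irreflexive adj.
  by move=> u; rewrite /adj orbb !inE; apply/negP => /and3P[_ /loopless/eqP].
have goodP e : e \in good -> [/\ e \in E, e.1 \in S & e.2 \in S].
  by rewrite !inE => /and3P[_ -> ]; rewrite /ends subUset !sub1set => /andP[].
have parity e f : e \in good -> f \in good -> uniq [:: e.1; e.2; f.1; f.2] ->
    crossing_parity before s e.1 e.2 f.1 f.2 = false.
  move=> ge gf U; have [eE e1S e2S] := goodP e ge; have [fE f1S f2S] := goodP f gf.
  apply: uncrossed => //; apply: contraTN ge => efX; rewrite !inE negb_and negbK.
  apply/orP; left; apply/imsetP; exists (e, f) => //.
  by rewrite inE efX /ends !subUset !sub1set e1S e2S f1S.
have even : even_drawing before S adj s.
  split=> // u w x y _ U /orP[]g /orP[]h.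
  - exact: (parity (u, w) (x, y)).
  - have U' : uniq [:: u; w; y; x] by rewrite (perm_uniq (s2 := [:: u; w; x; y])) // (perm_catCA [:: u; w; y] [:: x] [::]) (perm_catCA [:: x] [:: u; w]) /= perm_refl.
    rewrite crossing_parity_sym // crossing_parity_flip // -crossing_parity_sym //.
    exact: (parity (u, w) (y, x)).
  - have U' : uniq [:: w; u; x; y] by rewrite (perm_uniq (s2 := [:: u; w; x; y])) // (perm_catCA [:: w] [:: u]).
    rewrite crossing_parity_flip //.
    exact: (parity (w, u) (x, y)).
  rewrite crossing_parity_flip // crossing_parity_sym; last 2 first.
  - by [].
  - by rewrite (perm_uniq (s2 := [:: u; w; x; y])) // (perm_catCA [:: w] [:: u]).
  rewrite crossing_parity_flip //.
  have U' : uniq [:: y; x; w; u] by rewrite -[[:: y; x; w; u]]/(rev [:: u; w; x; y]) rev_uniq.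
  exact: (parity (y, x) (w, u)).
have := even_drawing_sparse tot adjC adjI even.
apply: leq_trans.
under eq_bigr do rewrite /degree -sum1_card.
rewrite pair_big_dep /= sum1_card.
apply: subset_leq_card; apply/subsetP => -[u w] g.
by have [_ /= uS wS] := goodP _ g; rewrite unfold_in /= inE uS wS /adj g.
Qed.

(** Average [card_edges_within] over a random S that contains each vertex with
    probability 1 / k: edges survive with probability 1 / k ^ 2, crossings of
    disjoint edges, having four endpoints, with probability 1 / k ^ 4.  Keeping k as
    a parameter avoids the fractional powers of the usual form. *)
Lemma crossing_inequality k :
  {in X, forall ef, ef.1 \in E /\ ef.2 \in E /\ uniq [:: ef.1.1; ef.1.2; ef.2.1; ef.2.2]} ->
  0 < k -> k ^ 2 * #|E| <= 15 * k ^ 3 * #|V| + #|X|.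
Proof.
move=> XE; case: k => // k _.
pose zeros (phi : {ffun V -> 'I_k.+1}) := [set v | phi v == ord0].
pose N (A : {set V}) := #|[set phi : {ffun V -> 'I_k.+1} | A \subset zeros phi]|.
have average (T : finType) (A : {set T}) (B : T -> {set V}) (m : nat) :
    {in A, forall x, #|B x| = m} ->
    (\sum_phi #|[set x in A | B x \subset zeros phi]|) * k.+1 ^ m = #|A| * k.+1 ^ #|V|.
  move=> Bm; under eq_bigr do rewrite -sum1_card big_mkcond /=.
  rewrite exchange_big /= [X in X * _](_ : _ = \sum_(x in A) N (B x)).
    rewrite big_distrl /= -sum_nat_const; apply: eq_bigr => x xA.
    by rewrite -(Bm x xA) card_vanishing.
  rewrite [RHS]big_mkcond; apply: eq_bigr => x _; rewrite /N -sum1_card [in RHS]big_mkcond /=.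
  case: (boolP (x \in A)) => xA; last by rewrite big1 // => phi _; rewrite inE (negbTE xA).
  by apply: eq_bigr => phi _; rewrite !inE xA.
have card2 : {in E, forall e, #|ends e| = 2} by move=> e /loopless; rewrite /ends cards2 => ->.
have card4 : {in X, forall ef, #|ends ef.1 :|: ends ef.2| = 4}.
  move=> ef /XE[_ [_ U]]; rewrite -[RHS](card_uniqP U) /ends; apply: eq_card => v.
  by rewrite !inE -!orbA.
have E2 := average _ E (@ends V) 2 card2.
have X4 := average _ X (fun ef => ends ef.1 :|: ends ef.2) 4 card4.
have V1 : (\sum_phi #|zeros phi|) * k.+1 = #|V| * k.+1 ^ #|V|.
  rewrite -[X in _ = X * _]cardsT -(average _ [set: V] (fun v => [set v]) 1 (fun _ _ => cards1 _)) expn1.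
  by congr (_ * _); apply: eq_bigr => phi _; apply: eq_card => v; rewrite !inE sub1set inE.
have H := leq_sum (index_enum {ffun V -> 'I_k.+1}) (fun phi (_ : predT phi) => card_edges_within (zeros phi)).
rewrite big_split /= -big_distrr /= in H.
set a := \sum_phi _ in E2 H; set b := \sum_phi _ in V1 H; set c := \sum_phi _ in X4 H.
have K0 : 0 < k.+1 ^ #|V| by rewrite expn_gt0.
rewrite -(leq_pmul2r K0) mulnDl -X4 -mulnA -E2 -mulnA -V1.
rewrite mulnA (mulnC _ a) -[X in X <= _]mulnA -expnD.
rewrite [X in _ <= X + _](_ : _ = 15 * b * k.+1 ^ 4); last by rewrite !expnS expn0; lia.
by rewrite -mulnDl leq_mul2r H orbT.
Qed.
End Crossings.

Local Open Scope classical_set_scope.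
Local Open Scope set_scope.
Local Open Scope ring_scope.

(** * Arcs of continuous functions *)

(** The difference of F and G has no zero, hence keeps its sign. *)
Lemma same_side (R : realType) (F G : R -> R) (a b : R) : a <= b ->
  {within `[a, b], continuous F} -> {within `[a, b], continuous G} ->
  (forall x, a <= x <= b -> F x <> G x) -> (F a < G a) = (F b < G b).
Proof.
move=> ab cF cG ne; pose H x := G x - F x.
have cH : {within `[a, b], continuous H}.
  by move=> x; apply: continuousB; [apply: cG|apply: cF].
have nz x : a <= x <= b -> H x != 0.
  by move=> /ne; rewrite /H subr_eq0 => /eqP; rewrite eq_sym.
rewrite -[LHS]subr_gt0 -[RHS]subr_gt0 -!/(H _).
have za : H a != 0 by apply: nz; rewrite lexx ab.
have zb : H b != 0 by apply: nz; rewrite lexx ab.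
case: (ltP 0 (H a)) => ha; case: (ltP 0 (H b)) => hb //.
- have [|x] := IVT ab cH (v := 0); first by rewrite ge_min le_max hb (ltW ha) orbT.
  by rewrite in_itv /= => /nz/eqP.
- have [|x] := IVT ab cH (v := 0); first by rewrite ge_min le_max (ltW hb) ha orbT.
  by rewrite in_itv /= => /nz/eqP.
Qed.

(** Ties in the first coordinate are broken by the second one, as if the plane were
    sheared slightly; a vertical pair of points needs an order, too. *)
Definition lex_before (R : realType) (V : finType) (pos : V -> R * R) : rel V :=
  fun v w => ((pos v).1 < (pos w).1) || (((pos v).1 == (pos w).1) && ((pos v).2 < (pos w).2)).

Lemma lex_before_total (R : realType) (V : finType) (pos : V -> R * R) :
  injective pos -> strict_total (lex_before pos).
Proof.
move=> inj u v uv; rewrite /lex_before.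
have : pos u != pos v by rewrite (inj_eq inj).
case: (pos u) (pos v) => [a b] [c d]; rewrite /= xpair_eqE /=.
by case: (ltgtP a c) => //= _ bd; rewrite -leNgt le_eqVlt eq_sym (negbTE bd).
Qed.

Lemma lex_before_trans (R : realType) (V : finType) (pos : V -> R * R) :
  transitive (lex_before pos).
Proof.
move=> v u w; rewrite /lex_before.
case: (pos u) (pos v) (pos w) => [a b] [c d] [e f] /=.
move=> /orP[h1|/andP[/eqP-> h1]] /orP[h2|/andP[/eqP<- h2]].
- by rewrite (lt_trans h1 h2).
- by rewrite h1.
- by rewrite h2.
- by rewrite eqxx (lt_trans h1 h2) orbT.
Qed.

Lemma lex_before_le (R : realType) (V : finType) (pos : V -> R * R) u v :
  lex_before pos u v -> (pos u).1 <= (pos v).1.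
Proof. by case/orP => [/ltW|/andP[/eqP-> _]]. Qed.

Lemma lex_before_irr (R : realType) (V : finType) (pos : V -> R * R) :
  irreflexive (lex_before pos).
Proof. by move=> u; rewrite /lex_before !ltxx andbF. Qed.

(** Disjoint arcs satisfy the parity condition: u is the leftmost of the four
    endpoints, and the three possible orders of w, x, y are separate ranges, nested
    ranges and interleaved ranges.  In the last two cases [same_side] compares the
    arcs at the ends of their common range. *)
Lemma disjoint_arcs_parity (R : realType) (V : finType) (pos : V -> R * R)
    (s : V -> V -> V -> bool) (F G : R -> R) u w x y :
  let before := lex_before pos in
  injective pos -> uniq [:: u; w; x; y] -> before u w -> before x y -> before u x ->
  {within `[(pos u).1, (pos w).1], continuous F} ->
  {within `[(pos x).1, (pos y).1], continuous G} ->
  F (pos w).1 = (pos w).2 -> G (pos x).1 = (pos x).2 -> G (pos y).1 = (pos y).2 ->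
  (forall v, s u w v = [&& before u v, before v w & F (pos v).1 < (pos v).2]) ->
  (forall v, s x y v = [&& before x v, before v y & G (pos v).1 < (pos v).2]) ->
  (forall z, (pos u).1 <= z <= (pos w).1 -> (pos x).1 <= z <= (pos y).1 -> F z <> G z) ->
  crossing_parity before s u w x y = false.
Proof.
move=> before inj; rewrite /= !inE !negb_or -!andbA => /and5P[uw ux uy wx /andP[wy /andP[xy _]]].
move=> b_uw b_xy b_ux cF cG Fw Gx Gy sF sG disj.
have tot : strict_total before := lex_before_total inj.
have tr : transitive before := @lex_before_trans R V pos.
have b_uy : before u y := tr _ _ _ b_ux b_xy.
have b_xu : before x u = false by rewrite (tot _ _ ux) b_ux.
rewrite /crossing_parity !sF !sG b_ux b_uy b_xu /= -Fw -Gx -Gy.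
have b_xw : before x w = ~~ before w x by apply: tot.
have b_yw : before y w = ~~ before w y by apply: tot.
rewrite b_xw b_yw; case b_wx: (before w x) => /=.
  by rewrite (tr _ _ _ b_wx b_xy).
rewrite b_wx in b_xw; have xw := lex_before_le b_xw.
have ux1 := lex_before_le b_ux; have xy1 := lex_before_le b_xy.
case b_wy: (before w y) => /=.
  have wy1 := lex_before_le b_wy.
  have side : (F (pos x).1 < G (pos x).1) = (F (pos w).1 < G (pos w).1).
    apply: same_side => // [||z /andP[z1 z2]].
    - by apply: continuous_subspaceW cF; apply: subset_itvr; rewrite bnd_simp.
    - by apply: continuous_subspaceW cG; apply: subset_itvl; rewrite bnd_simp.
    - by apply: disj; rewrite ?z1 ?z2 /= ?(le_trans ux1) // (le_trans z2).
  rewrite side; have : F (pos w).1 <> G (pos w).1.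
    by apply: disj; rewrite ?lexx ?xw ?wy1 ?(le_trans ux1).
  by case: ltgtP.
rewrite b_wy in b_yw; have yw := lex_before_le b_yw.
have -> : (F (pos x).1 < G (pos x).1) = (F (pos y).1 < G (pos y).1).
  apply: same_side => // [|z /andP[z1 z2]].
  - apply: continuous_subspaceW cF => z; rewrite /= !in_itv /= => /andP[z1 z2].
    by rewrite (le_trans ux1 z1) (le_trans z2 yw).
  - by apply: disj; rewrite ?z1 ?z2 /= ?(le_trans ux1) // (le_trans z2).
by case: (_ < _).
Qed.

(** * Incidences between points and curves *)

(** These pairs are the edges along one curve, when A is the set of its points. *)
Definition consecutive (V : finType) (before : rel V) (A : {set V}) (v w : V) :=
  [&& v \in A, w \in A, before v w & [forall u in A, ~~ (before v u && before u w)]].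

(** Every element of A but the last one has a successor. *)
Lemma card_consecutive (V : finType) (before : rel V) (A : {set V}) :
  strict_total before -> transitive before -> irreflexive before ->
  (#|A| <= #|[set vw | consecutive before A vw.1 vw.2]| + 1)%N.
Proof.
move=> tot tr irr; set P := [set vw | _].
have succ v w : v \in A -> w \in A -> before v w -> exists w', (v, w') \in P.
  move=> vA wA vw; pose rank u := #|[set x | before x u]|.
  have w0 : [pred x | (x \in A) && before v x] w by rewrite /= wA vw.
  case: (arg_minnP rank w0) => w' /= /andP[w'A vw'] minw'.
  exists w'; rewrite inE /consecutive /= vA w'A vw' /=; apply/forall_inP => u uA.
  apply/negP => /andP[vu uw']; have := minw' u; rewrite uA vu => /(_ isT).
  apply/negP; rewrite -ltnNge; apply: proper_card; apply/properP; split.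
    by apply/fintype.subsetP => x; rewrite !inE => xu; apply: tr uw'.
  by exists u; rewrite !inE ?irr.
apply: leq_trans (_ : (#|A :&: fst @: P| + #|A :\: fst @: P| <= _)%N).
  by rewrite cardsID.
apply: leq_add.
  by apply: leq_trans (leq_imset_card fst P); apply: subset_leq_card; apply: subsetIr.
apply/card_le1P => v; rewrite !inE => /andP[vP vA] w.
rewrite !inE; apply/idP/eqP => [/andP[wP wA]|->]; last by rewrite vP.
apply/eqP; apply: contraNT vP => wv.
have last u x : u \in A -> x \in A -> before u x -> u \in fst @: P.
  by move=> uA xA /(succ _ _ uA xA)[x' uxP]; apply/imsetP; exists (u, x').
case vw: (before v w); first exact: (last v w).
by case/negP: wP; apply: (last w v) => //; rewrite tot ?vw // eq_sym.
Qed.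

(** Curves are the graphs of the functions [g n] over intervals [D n]; two of them
    meet at most c times, and two points lie on at most c of them. *)
Section Incidences.
Variables (R : realType) (V L : finType) (pos : V -> R * R).
Variables (D : L -> set R) (g : L -> R -> R) (c : nat).

Definition incident (v : V) (n : L) := `[< D n (pos v).1 >] && (g n (pos v).1 == (pos v).2).

Hypothesis pos_inj : injective pos.
Hypothesis D_interval : forall n, is_interval (D n).
Hypothesis g_cont : forall n, {within D n, continuous (g n)}.
Hypothesis few_meets : forall n n' (xs : seq R), n != n' -> uniq xs ->
  (forall x, x \in xs -> [/\ D n x, D n' x & g n x = g n' x]) -> (size xs <= c)%N.
Hypothesis few_joins : forall v w, v != w -> (#|[set n | incident v n & incident w n]| <= c)%N.

Let before := lex_before pos.
Let on n := [set v | incident v n].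
Let edge n (e : V * V) := consecutive before (on n) e.1 e.2.
(* Two points may be consecutive on several curves; [curve] selects one of them to
   draw the edge, so that the graph is simple. *)
Let E := [set e | [exists n, edge n e]].
Let curve e := [pick n | edge n e].
Let height e x := if curve e is Some n then g n x else 0.
Let x1 (e : V * V) := (pos e.1).1.
Let x2 (e : V * V) := (pos e.2).1.
Let meets e f z := [/\ x1 e <= z <= x2 e, x1 f <= z <= x2 f & height e z = height f z].
Let X := [set ef : (V * V) * (V * V) | [&& ef.1 \in E, ef.2 \in E,
  uniq [:: ef.1.1; ef.1.2; ef.2.1; ef.2.2] & `[< exists z, meets ef.1 ef.2 z >]]].

Let curveP e : e \in E -> exists2 n, curve e = Some n & edge n e.
Proof.
rewrite inE => /existsP[n ne]; rewrite /curve; case: pickP => [m me|/(_ n)]; first by exists m.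
by rewrite ne.
Qed.

Let edgeP n e : edge n e -> [/\ incident e.1 n, incident e.2 n, before e.1 e.2 &
  forall u, incident u n -> before e.1 u -> before u e.2 -> False].
Proof.
rewrite /edge /consecutive !inE => /and4P[-> -> -> /forall_inP h]; split=> // u un eu ue.
by have := h u; rewrite inE un eu ue => /(_ isT).
Qed.

Let D_edge n e z : edge n e -> x1 e <= z <= x2 e -> D n z.
Proof.
by case/edgeP => /andP[/asboolP d1 _] /andP[/asboolP d2 _] _ _; apply: D_interval.
Qed.

Let same_pos n u v : incident u n -> incident v n -> (pos u).1 = (pos v).1 -> u = v.
Proof.
move=> /andP[_ /eqP u2] /andP[_ /eqP v2] E1; apply: pos_inj.
by rewrite [pos u]surjective_pairing [pos v]surjective_pairing -u2 -v2 E1.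
Qed.

Let before_of_lt u v : (pos u).1 < (pos v).1 -> before u v.
Proof. by rewrite /before /lex_before => ->. Qed.

(** An endpoint of e on the arc of f would be a further point of the curve of f
    between two consecutive ones. *)
Let meet_off_end n n' e f z : edge n e -> edge n' f ->
  uniq [:: e.1; e.2; f.1; f.2] -> x1 f <= z <= x2 f -> g n z = g n' z ->
  z != x1 e /\ z != x2 e.
Proof.
move=> en fn U zf gz.
have [e1n e2n _ _] := edgeP en; have [f1n f2n _ nof] := edgeP fn.
have off u : incident u n -> u != f.1 -> u != f.2 -> z != (pos u).1.
  move=> un uf1 uf2; apply/eqP => zu.
  have un' : incident u n'.
    apply/andP; split; first by apply/asboolP; rewrite -zu; apply: D_edge fn zf.
    by rewrite -zu -gz zu; case/andP: un.
  have lt1 : (pos f.1).1 < (pos u).1.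
    rewrite -zu lt_neqAle; case/andP: zf => -> _; rewrite andbT.
    by apply: contraNneq uf1; rewrite zu => /(same_pos f1n un') ->.
  have lt2 : (pos u).1 < (pos f.2).1.
    rewrite -zu lt_neqAle; case/andP: zf => _ ->; rewrite andbT.
    by apply: contraNneq uf2; rewrite zu => /(same_pos un' f2n) ->.
  exact: (nof u un' (before_of_lt lt1) (before_of_lt lt2)).
move: U; rewrite /= !inE !negb_or -!andbA => /and5P[_ ? ? ? /andP[? _]].
by split; apply: off.
Qed.

Let meet_interior n n' e f z : edge n e -> edge n' f ->
  uniq [:: e.1; e.2; f.1; f.2] -> x1 e <= z <= x2 e -> x1 f <= z <= x2 f -> g n z = g n' z ->
  x1 e < z < x2 e.
Proof.
move=> en fn U /andP[ze1 ze2] zf gz; have [n1 n2] := meet_off_end en fn U zf gz.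
by rewrite !lt_neqAle ze1 ze2 n2 eq_sym n1.
Qed.

(** The arcs between consecutive points of one curve do not overlap. *)
Let edge_at n e e' z : edge n e -> edge n e' -> x1 e < z < x2 e -> x1 e' < z < x2 e' -> e = e'.
Proof.
move=> en en' /andP[z1 z2] /andP[z1' z2'].
have [e1 e2 _ no] := edgeP en; have [e1' e2' _ no'] := edgeP en'.
have b1 := before_of_lt (lt_trans z1 z2'); have b2 := before_of_lt (lt_trans z1' z2).
have tot := lex_before_total pos_inj.
have E1 : e.1 = e'.1.
  apply/eqP; apply: contraT => ne; case b: (before e.1 e'.1).
    by case: (no _ e1' b b2).
  by case: (no' _ e1 _ b1); rewrite /before (tot _ _ ne) -/before b.
have E2 : e.2 = e'.2.
  apply/eqP; apply: contraT => ne; case b: (before e.2 e'.2).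
    by case: (no' _ e2 b2 b).
  by case: (no _ e2' b1 _); rewrite /before (tot _ _ ne) -/before b.
by rewrite [e]surjective_pairing E1 E2 -surjective_pairing.
Qed.

(** A crossing is determined by the two curves and one of their at most c common
    points, since on each curve only one arc passes over a given abscissa. *)
Let card_crossings : (#|X| <= c * #|L| ^ 2)%N.
Proof.
pose fiber nn' := [set ef in X | (curve ef.1 == Some nn'.1) && (curve ef.2 == Some nn'.2)].
have cover : X \subset \bigcup_(nn' : L * L) fiber nn'.
  apply/fintype.subsetP => ef efX; have := efX; rewrite inE => /and4P[/curveP[n nE _] /curveP[n' n'E _] _ _].
  by apply/bigcupP; exists (n, n'); rewrite // inE efX nE n'E !eqxx.
apply: leq_trans (subset_leq_card cover) _.
apply: (@leq_trans (\sum_(nn' : L * L) c)); last first.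
  by rewrite sum_nat_const card_prod mulnC.
apply: (big_ind2 (fun (A : {set _}) m => (#|A| <= m)%N)) => [|A a B b Aa Bb|[n n'] _].
- by rewrite cards0.
- by apply: leq_trans (leq_add Aa Bb); rewrite -cardsUI leq_addr.
have fiberP ef : ef \in fiber (n, n') -> exists z, [/\ edge n ef.1, edge n' ef.2,
    x1 ef.1 < z < x2 ef.1, x1 ef.2 < z < x2 ef.2 & g n z = g n' z /\ ef.1 != ef.2].
  rewrite inE => /andP[]; rewrite inE => /and4P[eE fE U /asboolP[z [ze zf gz]]] /andP[/eqP en /eqP fn].
  move: en fn gz => /= en fn; rewrite /height en fn => gz; exists z.
  have [m em en'] := curveP eE; have [m' fm fn'] := curveP fE.
  move: em fm en' fn'; rewrite en fn => -[<-] [<-] en' fn'; split=> //.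
  - exact: meet_interior en' fn' U ze zf gz.
  - apply: meet_interior fn' en' _ zf ze (esym gz).
    by rewrite -[[:: ef.2.1; _; _; _]]/([:: ef.2.1; ef.2.2] ++ [:: ef.1.1; ef.1.2]) uniq_catC.
  - split=> //; apply: contraTneq U => ->; by rewrite /= !inE eqxx orbT.
have [nn'|nn'] := eqVneq n n'.
  suff -> : fiber (n, n') = finset.set0 by rewrite cards0.
  apply/finset.setP => ef; rewrite [RHS]inE; apply/negP => /fiberP[z [en fn ze zf [_]]].
  by rewrite -nn' in fn; rewrite (edge_at en fn ze zf) eqxx.
have /choice[zf zfP] : forall ef, exists z, ef \in fiber (n, n') -> [/\ edge n ef.1, edge n' ef.2,
    x1 ef.1 < z < x2 ef.1, x1 ef.2 < z < x2 ef.2 & g n z = g n' z /\ ef.1 != ef.2].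
  by move=> ef; have [/fiberP[z hz]|_] := boolP (ef \in fiber (n, n')); [exists z|exists 0].
rewrite cardE -(size_map zf); apply: (few_meets nn').
  rewrite map_inj_in_uniq ?enum_uniq // => ef ef'; rewrite !mem_enum => /zfP[en fn ze zf' _] /zfP[en' fn' ze' zf'' _] E1.
  rewrite [ef]surjective_pairing [ef']surjective_pairing.
  rewrite -E1 in ze' zf''; congr (_, _); [exact: edge_at en en' ze ze' | exact: edge_at fn fn' zf' zf''].
move=> z /mapP[ef]; rewrite mem_enum => /zfP[en fn /andP[/ltW a /ltW b] /andP[/ltW a' /ltW b'] [gz _]] ->.
by split=> //; [apply: D_edge en _; rewrite a b | apply: D_edge fn _; rewrite a' b'].
Qed.

Let oriented u w := if before u w then (u, w) else (w, u).
Let side u w v := let e := oriented u w in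
  [&& before e.1 v, before v e.2 & height e (pos v).1 < (pos v).2].

(** By [disjoint_arcs_parity], disjoint edges that do not meet have even parity. *)
Let card_edges k : (0 < k)%N -> (k ^ 2 * #|E| <= 15 * k ^ 3 * #|V| + c * #|L| ^ 2)%N.
Proof.
move=> k0; have tot : strict_total before := lex_before_total pos_inj.
have Ebefore e : e \in E -> before e.1 e.2 by move=> /curveP[n _ /edgeP[]].
have orE e : e \in E -> oriented e.1 e.2 = e.
  by move=> /Ebefore; rewrite /oriented => ->; rewrite -surjective_pairing.
have sideC u w v : side u w v = side w u v.
  rewrite /side /oriented; have [->|uw] := eqVneq u w; first by [].
  by rewrite (tot _ _ uw); case: (before u w).
apply: leq_trans (leq_add (leqnn _) card_crossings).
apply: (@crossing_inequality V before E X side) => //.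
- move=> e /Ebefore; apply: contraTneq => ->; by rewrite /before lex_before_irr.
- move=> e f eE fE U nX.
  have [n en edn] := curveP eE; have [n' fn edn'] := curveP fE.
  have hE e' v : e' \in E -> side e'.1 e'.2 v =
      [&& before e'.1 v, before v e'.2 & height e' (pos v).1 < (pos v).2].
    by move=> e'E; rewrite /side orE.
  have ht m e' : e' \in E -> curve e' = Some m -> edge m e' ->
      [/\ {within `[x1 e', x2 e'], continuous (height e')},
      height e' (pos e'.1).1 = (pos e'.1).2 & height e' (pos e'.2).1 = (pos e'.2).2].
    move=> e'E em med; have [/andP[_ /eqP m1] /andP[_ /eqP m2] _ _] := edgeP med.
    have -> : height e' = g m by apply/funext => z; rewrite /height em.
    split=> //; apply: continuous_subspaceW (@g_cont m) => z /=; rewrite in_itv /=.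
    exact: D_edge med.
  have [cF F1 F2] := ht n e eE en edn; have [cG G1 G2] := ht n' f fE fn edn'.
  have no z : x1 e <= z <= x2 e -> x1 f <= z <= x2 f -> height e z <> height f z.
    move=> ze zf hz; case/negP: nX; rewrite finset.in_set; apply/and4P; split=> //.
    by apply/asboolP; exists z.
  case b: (before e.1 f.1).
    exact: (disjoint_arcs_parity pos_inj U (Ebefore e eE) (Ebefore f fE) b cF cG F2 G1 G2
      (fun v => hE e v eE) (fun v => hE f v fE) no).
  have U' : uniq [:: f.1; f.2; e.1; e.2].
    by rewrite -[[:: f.1; _; _; _]]/([:: f.1; f.2] ++ [:: e.1; e.2]) uniq_catC.
  have b' : before f.1 e.1.
    have ef : e.1 != f.1 by move: U; rewrite /= !inE !negb_or -!andbA => /and5P[].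
    by rewrite (tot _ _ ef) b.
  rewrite crossing_parity_sym //.
  apply: (disjoint_arcs_parity pos_inj U' (Ebefore f fE) (Ebefore e eE) b' cG cF G2 F1 F2
      (fun v => hE f v fE) (fun v => hE e v eE)).
  by move=> z ze zf /esym; apply: no.
- by move=> ef; rewrite inE => /and4P[].
Qed.

(** A curve with i points carries at least i - 1 edges, and an edge is counted for
    at most c curves.  The choice k ^ 3 = #|L| ^ 2 / #|V| gives the familiar bound
    by #|V| ^ (2/3) * #|L| ^ (2/3); the weighted form below profits from a free k. *)
Lemma szemeredi_trotter k : (0 < k)%N ->
  (k ^ 2 * (\sum_n #|[set v | incident v n]|) <=
   k ^ 2 * #|L| + c * (15 * k ^ 3 * #|V| + c * #|L| ^ 2))%N.
Proof.
move=> k0.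
have tot : strict_total before := lex_before_total pos_inj.
have irr : irreflexive before := lex_before_irr pos.
have count : (\sum_n #|on n| <= c * #|E| + #|L|)%N.
  apply: (@leq_trans (\sum_n (#|[set e | edge n e]| + 1))%N).
    apply: leq_sum => n _; apply: card_consecutive => //; exact: lex_before_trans.
  rewrite big_split /= sum1_card leq_add2r.
  under eq_bigr do rewrite -sum1_card big_mkcond /=.
  rewrite exchange_big /= mulnC -sum_nat_const [leqRHS]big_mkcond /=; apply: leq_sum => e _.
  case: ifPn => [/curveP[n _ /edgeP[e1 e2 b _]]|eE].
    have ne : e.1 != e.2 by apply: contraTneq b => ->; rewrite irr.
    apply: leq_trans (few_joins ne); rewrite -sum1_card [leqRHS]big_mkcond /=; apply: leq_sum => m _.
    by rewrite !inE; case: ifP => // /edgeP[-> ->].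
  by rewrite big1 // => n _; rewrite inE; case: ifPn => // ne; case/negP: eE; rewrite inE; apply/existsP; exists n.
apply: (@leq_trans (k ^ 2 * (c * #|E| + #|L|))); first by rewrite leq_mul2l count orbT.
have H := card_edges k0.
by rewrite mulnDr addnC leq_add2l mulnCA leq_mul2l H orbT.
Qed.
End Incidences.

(** * Translates of a graph of a function *)

Lemma card_at_most_size (R : realType) (T : choiceType) (S : set T) (C : R) (c : nat) (xs : seq T) :
  card_at_most S C -> C <= c%:R -> uniq xs -> (forall x, x \in xs -> S x) -> (size xs <= c)%N.
Proof.
move=> [fin card] Cc U sub; rewrite -(ler_nat R); apply: le_trans Cc; apply: le_trans card.
rewrite ler_nat cardfE cardE -(size_map val).
apply: uniq_leq_size => // x /sub Sx.
have xS : x \in fset_set S by rewrite in_fset_set // mem_set.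
by apply/mapP; exists [` xS]%fset; rewrite ?mem_enum.
Qed.

Section Translates.
Variables (R : realType) (I : interval R) (psi : R -> R) (C : R) (c : nat).
Hypothesis Cc : C <= c%:R.
Hypothesis psi_cont : {within [set` I], continuous psi}.
Hypothesis few_differences : forall d1 d2 : R, d1 != 0 -> card_at_most (diff_solutions I psi d1 d2) C.

Definition on_graph (m : R * R) := (m.1 \in I) && (m.2 == psi m.1).

Lemma reflected_arc_cont (n : R * R) :
  {within [set x | n.1 - x \in I], continuous (fun x => n.2 - psi (n.1 - x))}.
Proof.
apply/subspace_continuousP => x /= xI; apply: cvgB; first exact: cvg_cst.
have /subspace_continuousP/(_ (n.1 - x) xI) cpsi := psi_cont.
have flip : (fun y : R => n.1 - y) @ x --> n.1 - x by apply: cvgB; [exact: cvg_cst|exact: cvg_id].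
move=> U /cpsi hU; apply: (@filterS _ (nbhs x) _ _ _ _ (flip _ hU)) => y /= hy yI; exact: hy.
Qed.

(** The curves are n - graph, for n in Q.  Common points of two of them, and
    curves through two given points, both correspond to two points of the graph
    with a prescribed difference. *)
Lemma incidences_of_translates (P Q : {fset R * R}) k : (0 < k)%N ->
  (k ^ 2 * (\sum_(n <- Q) \sum_(m <- P) on_graph (n - m)%R) <=
   k ^ 2 * #|` Q| + c * (15 * k ^ 3 * #|` P| + c * #|` Q| ^ 2))%N.
Proof.
move=> k0.
pose D (n : Q) := [set x | (val n).1 - x \in I]%classic.
pose g (n : Q) x := (val n).2 - psi ((val n).1 - x).
have incE (m : P) (n : Q) : incident val D g m n = on_graph (val n - val m).
  rewrite /incident /on_graph /D /g /= asboolb; congr (_ && _).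
  by rewrite subr_eq addrC -subr_eq eq_sym.
have -> : (\sum_(n <- Q) \sum_(m <- P) on_graph (n - m)%R =
    \sum_(n : Q) #|[set m : P | incident val D g m n]|)%N.
  rewrite big_seq_fsetE /=; apply: eq_bigr => n _.
  rewrite big_seq_fsetE /= -sum1_card [RHS]big_mkcond; apply: eq_bigr => m _.
  by rewrite inE incE; case: (on_graph _).
rewrite !cardfE; apply: szemeredi_trotter => //.
- move=> n x y /= xI yI z /andP[xz zy].
  apply: (@interval_is_interval R I ((val n).1 - y) ((val n).1 - x) yI xI).
  by rewrite !lerD2l !lerN2 xz zy.
- by move=> n; apply: reflected_arc_cont.
- move=> n n' xs nn' U meet.
  (* curves that differ by a vertical translation are disjoint *)
  have [d|d] := eqVneq (val n).1 (val n').1.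
    case: xs U meet => // x xs _ /(_ x (mem_head _ _))[_ _]; rewrite /g d => /addIr d2.
    by case/eqP: nn'; apply: val_inj; rewrite [LHS]surjective_pairing d d2 -surjective_pairing.
  rewrite -(size_map (fun x => ((val n).1 - x, (val n').1 - x))).
  have d1 : (val n).1 - (val n').1 != 0 by rewrite subr_eq0.
  apply: (card_at_most_size (few_differences ((val n).2 - (val n').2) d1) Cc).
    by rewrite map_inj_uniq // => x y [/addrI/oppr_inj].
  move=> _ /mapP[x /meet[nI n'I gx] ->]; split=> //=; first by ring.
  by move: gx; rewrite /g; lra.
- move=> v w vw; rewrite cardE -(size_map (fun n : Q => ((val n).1 - (val v).1, (val n).1 - (val w).1))).
  (* no curve passes through two points of one vertical line *)
  have [d|d] := eqVneq (val v).1 (val w).1.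
    suff -> : enum [set n | incident val D g v n & incident val D g w n] = [::] by [].
    apply/eqP; rewrite -size_eq0 -cardE cards_eq0; apply/eqP/finset.setP => n.
    rewrite !inE; apply/negP => /andP[/andP[_ /eqP v2] /andP[_ /eqP w2]].
    case/eqP: vw; apply: val_inj.
    by rewrite [val v]surjective_pairing [val w]surjective_pairing -v2 -w2 d.
  have d1 : (val w).1 - (val v).1 != 0 by rewrite subr_eq0 eq_sym.
  apply: (card_at_most_size (few_differences ((val w).2 - (val v).2) d1) Cc).
    rewrite map_inj_in_uniq ?enum_uniq // => n n'; rewrite !mem_enum !inE.
    move=> /andP[/andP[_ /eqP v2] _] /andP[/andP[_ /eqP v2'] _] [/addIr E1 _].
    apply: val_inj; rewrite [val n]surjective_pairing [val n']surjective_pairing E1.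
    congr (_, _); move: v2 v2'; rewrite /g E1; lra.
  move=> xy /mapP[n]; rewrite mem_enum !inE => /andP[/andP[/asboolP vI /eqP v2] /andP[/asboolP wI /eqP w2]] ->.
  split=> //=; first by ring.
  by move: v2 w2; rewrite /g; lra.
Qed.
End Translates.

(** * Rich translates *)

(** Telescoping: 1 / x ^ 2 <= 2 / x - 2 / (x + 1) for x >= 1. *)
Lemma sum_inv_squares (R : realFieldType) (T M : nat) : (0 < T)%N ->
  \sum_(t < M) (((T + t)%:R : R) ^+ 2)^-1 <= 2 / T%:R.
Proof.
move=> T0; apply: (@le_trans _ _ (2 / T%:R - 2 / (T + M)%:R)); last first.
  by rewrite gerBl divr_ge0 ?ler0n.
elim: M => [|M IH]; first by rewrite big_ord0 addn0 subrr.
rewrite big_ord_recr /=; apply: le_trans (lerD IH (lexx _)) _.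
rewrite addnS -[(T + M).+1%:R]natr1; set x := (T + M)%:R.
have x1 : 1 <= x by rewrite /x ler1n addn_gt0 T0.
suff : (x ^+ 2)^-1 <= 2 / x - 2 / (x + 1) by lra.
have -> : 2 / x - 2 / (x + 1) = 2 / (x * (x + 1)) by field; rewrite !gt_eqF //; lra.
have x2 : 0 < x ^+ 2 by rewrite exprn_gt0 //; lra.
have xx : 0 < x * (x + 1) by rewrite mulr_gt0 //; lra.
rewrite ler_pdivlMr // mulrC ler_pdivrMr // expr2 mulrDr mulr1.
have : x * 1 <= x * x by rewrite ler_wpM2l //; lra.
lra.
Qed.

(** A discrete layer-cake formula for r ^ 2 above the level k0; below it, r ^ 2 is
    at most k0 * r. *)
Lemma square_le_tail_sum (k0 M r : nat) : (r <= k0 + M)%N ->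
  (r * r <= k0 * r + \sum_(t < M) (k0 + 1 + t <= r) * (2 * (k0 + 1 + t)))%N.
Proof.
elim: M r => [|M IH] r hr; first by rewrite big_ord0 addn0 leq_mul2r -[X in (_ <= X)%N]addn0 hr orbT.
rewrite big_ord_recr /=; have [h|h] := leqP r (k0 + M).
  by apply: leq_trans (IH r h) _; rewrite addnA leq_addr.
have rE : r = (k0 + M).+1 by lia.
have := IH (k0 + M)%N (leqnn _).
have : (\sum_(t < M) (k0 + 1 + t <= k0 + M) * (2 * (k0 + 1 + t)) <=
    \sum_(t < M) (k0 + 1 + t <= r) * (2 * (k0 + 1 + t)))%N.
  apply: leq_sum => t _; case: (leqP (k0 + 1 + t) (k0 + M)) => // h'.
  by have -> : (k0 + 1 + t <= r)%N by lia.
set a := (\sum_(t < M) _)%N; set b := (\sum_(t < M) _)%N.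
rewrite rE; have -> : (k0 + 1 + M <= (k0 + M).+1)%N by lia.
nia.
Qed.

Lemma sum_count_lt (w M : nat) : (w <= M)%N -> (\sum_(t < M) (t < w))%N = w.
Proof.
move=> wM; rewrite -[RHS]card_ord -sum1_card.
rewrite (big_ord_widen M (fun=> 1)%N wM) [RHS]big_mkcond.
by apply: eq_bigr => t _; case: (t < w)%N.
Qed.

(** From here on only the incidence bound matters: [inc] is any relation that
    satisfies it, and the points carry weights w with sum W and sum of squares E. *)
Section RichTranslates.
Variables (R : realFieldType) (G : choiceType) (inc : rel G) (c : nat).
Hypothesis c0 : (0 < c)%N.
Hypothesis incidence_bound : forall (P Q : {fset G}) k, (0 < k)%N ->
  (k ^ 2 * (\sum_(n <- Q) \sum_(m <- P) inc m n) <=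
   k ^ 2 * #|` Q| + c * (15 * k ^ 3 * #|` P| + c * #|` Q| ^ 2))%N.

Variables (P : {fset G}) (w : G -> nat) (M : nat).
Hypothesis wM : forall m, (w m <= M)%N.
Let W := (\sum_(m <- P) w m)%N.
Let E := (\sum_(m <- P) w m * w m)%N.
Hypothesis W0 : (0 < W)%N.

Let WE : (W <= E)%N.
Proof. by apply: leq_sum => m _; case: (w m) => // v; rewrite leq_pmull. Qed.

Definition richness n := (\sum_(m <- P) w m * inc m n)%N.

(** The typical weight of a point, when points are chosen proportionally to w. *)
Let T := (E %/ W)%N.
Let T0 : (0 < T)%N. Proof. by rewrite divn_gt0. Qed.

(** Split the weights into layers {m | t < w m} and apply the incidence bound to
    each with a parameter k_t of its own.  The bound for one layer has a term
    k_t * #|layer| and a term 1 / k_t ^ 2; taking k_t = kappa up to t = T and growing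
    linearly beyond makes both sums converge, the first to O(kappa W) because
    sum_t t * #|layer| is at most E, the second to O(T / kappa ^ 2).  A constant k_t
    would lose a factor M / T. *)
Let total_richness (Q : {fset G}) kappa : (0 < kappa)%N ->
  (\sum_(n <- Q) richness n)%:R <= (M * #|` Q| + 45 * c * kappa * W)%:R
    + (8 * c ^ 2 * #|` Q| ^ 2 * T)%:R / (kappa%:R ^+ 2) :> R.
Proof.
move=> k0; pose k t := (kappa * (1 + t %/ T))%N.
have kt0 t : (0 < k t)%N by rewrite muln_gt0 k0.
pose Pt t := [fset m in P | (t < w m)%N]%fset.
pose J t := (\sum_(n <- Q) \sum_(m <- Pt t) inc m n)%N.
have layers : (\sum_(n <- Q) richness n = \sum_(t < M) J t)%N.
  rewrite /J [RHS]exchange_big /=; apply: eq_bigr => n _.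
  under [RHS]eq_bigr do rewrite big_fset big_mkcond /=.
  rewrite exchange_big /=; apply: eq_bigr => m _.
  rewrite -[X in (X * _)%N](sum_count_lt (wM m)) big_distrl /=; apply: eq_bigr => t _.
  by case: (t < w m)%N; rewrite ?mul1n.
have layer t : (J t)%:R <= (#|` Q| + 15 * c * (k t * #|` Pt t|))%:R
    + (c ^ 2 * #|` Q| ^ 2)%:R / (k t)%:R ^+ 2 :> R.
  have k2 : 0 < (k t)%:R ^+ 2 :> R by rewrite exprn_gt0 ?ltr0n.
  rewrite -(ler_pM2r k2) mulrDl divfK ?gt_eqF // -natrX -!natrM -natrD ler_nat.
  have := incidence_bound (Pt t) Q (kt0 t); rewrite -/(J t).
  by rewrite mulnC => /leq_trans; apply; rewrite eq_leq //; ring.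
have weights : (\sum_(t < M) k t * #|` Pt t| <= 3 * kappa * W)%N.
  rewrite -(leq_pmul2l T0) big_distrr /=.
  apply: (@leq_trans (kappa * (T * W + E))%N); last first.
    have h : (T * W + E <= 3 * (T * W))%N.
      have := ltn_ceil E W0; rewrite -/T.
      have : (1 * W <= T * W)%N by rewrite leq_mul2r T0 orbT.
      by rewrite mulSn; lia.
    by apply: leq_trans (leq_mul (leqnn kappa) h) _; rewrite eq_leq //; ring.
  rewrite /W /E !big_distrr -big_split /= big_distrr /=.
  under eq_bigr => t _ do rewrite card_fset_sum1 big_fset big_mkcond !big_distrr /=.
  rewrite exchange_big /=; apply: leq_sum => m _.
  rewrite -mulnDl mulnA.
  apply: (@leq_trans (\sum_(t < M) (t < w m) * (kappa * (T + w m)))%N); last first.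
    by rewrite -big_distrl /= sum_count_lt // mulnC.
  apply: leq_sum => t _; case: ifP => [tw|]; last by rewrite !muln0.
  rewrite mul1n muln1 /k mulnCA leq_mul2l mulnDr muln1 leq_add2l; apply/orP; right.
  by rewrite mulnC; apply: leq_trans (leq_trunc_div _ _) (ltnW tw).
have squares : \sum_(t < M) ((k t)%:R ^+ 2)^-1 <= 8 * T%:R / kappa%:R ^+ 2 :> R.
  apply: (@le_trans _ _ (\sum_(t < M) 4 * T%:R ^+ 2 / kappa%:R ^+ 2 * ((T + t)%:R ^+ 2)^-1)).
    apply: ler_sum => t _.
    have a0 : 0 < kappa%:R ^+ 2 :> R by rewrite exprn_gt0 ?ltr0n.
    have b0 : 0 < (T + t)%:R ^+ 2 :> R by rewrite exprn_gt0 ?ltr0n ?addn_gt0 ?T0.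
    have d0 : 0 < (k t)%:R ^+ 2 :> R by rewrite exprn_gt0 ?ltr0n.
    have ab : 0 < kappa%:R ^+ 2 * (T + t)%:R ^+ 2 :> R by rewrite mulr_gt0.
    rewrite -[leRHS]mulrA -invfM ler_pdivlMr // mulrC ler_pdivrMr //.
    rewrite -!natrX -!natrM ler_nat.
    have h : (T + t <= 2 * T * (1 + t %/ T))%N.
      have := ltn_ceil t T0; set q := (t %/ T)%N.
      have -> : (2 * T * (1 + q) = 2 * T + 2 * (q * T))%N by ring.
      by rewrite mulSn; set qT := (q * T)%N; lia.
    apply: (@leq_trans (kappa ^ 2 * (2 * T * (1 + t %/ T)) ^ 2)%N).
      by rewrite leq_mul2l leq_exp2r ?h ?orbT.
    by rewrite /k eq_leq //; ring.
  rewrite -mulr_sumr; apply: le_trans (ler_wpM2l _ (sum_inv_squares R M T0)) _.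
    by rewrite divr_ge0 ?mulr_ge0 ?exprn_ge0 ?ler0n.
  have T1 : (T%:R : R) != 0 by rewrite pnatr_eq0 -lt0n.
  have kap1 : (kappa%:R : R) != 0 by rewrite pnatr_eq0 -lt0n.
  by rewrite le_eqVlt; apply/orP; left; apply/eqP; field; rewrite kap1 T1.
rewrite layers natr_sum; apply: le_trans (ler_sum (index_enum 'I_M) (fun t (_ : predT t) => layer t)) _.
rewrite big_split /= -natr_sum -mulr_sumr; apply: lerD.
  rewrite ler_nat big_split /= sum_nat_const card_ord leq_add2l -big_distrr /=.
  by apply: leq_trans (leq_mul (leqnn _) weights) _; rewrite eq_leq //; ring.
apply: le_trans (ler_wpM2l _ squares) _; first by rewrite ler0n.
by rewrite !mulrA ler_wpM2r ?invr_ge0 ?exprn_ge0 ?ler0n // -!natrM ler_nat eq_leq //; ring.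
Qed.

(* [a] is four times the coefficient 45 * c of kappa * W in [total_richness]. *)
Let a := (180 * c)%N.
Definition rich_constant := (128 * c ^ 2 * a ^ 2 + a)%N.

(** Points of Q have richness at least tau, so tau * #|Q| is at most the total
    richness, and the term M * #|Q| is absorbed as tau >= 2 * M.  Take for kappa the
    largest integer for which the term in kappa * W is absorbed as well; the
    remaining term gives the bound by W * E / tau ^ 3.  When even kappa = 1 is too
    large, tau * #|Q| < a * W, which is the second summand. *)
Lemma card_rich (Q : {fset G}) (tau : nat) : (0 < tau)%N -> (2 * M <= tau)%N ->
  (forall n, n \in Q -> (tau <= richness n)%N) ->
  (tau ^ 3 * #|` Q| <= rich_constant * (W * (E + tau ^ 2)))%N.
Proof.
move=> t0 tM rich; set q := #|` Q|.
have a0 : (0 < a)%N by rewrite /a muln_gt0.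
have TW : (T * W <= E)%N by exact: leq_trunc_div.
have low : (tau * q <= \sum_(n <- Q) richness n)%N.
  rewrite /q card_fset_sum1 big_distrr /= big_seq [leqRHS]big_seq.
  by apply: leq_sum => n nQ; rewrite muln1 rich.
have aW0 : (0 < a * W)%N by rewrite muln_gt0 a0.
have [lt|] := ltnP (tau * q) (a * W).
  rewrite /rich_constant; have : (tau ^ 2 * (tau * q) <= tau ^ 2 * (a * W))%N by rewrite leq_mul2l (ltnW lt) orbT.
  rewrite !expnS expn0; nia.
rewrite -(divn_gt0 _ aW0); set kappa := (_ %/ _)%N => k0.
have kup : (kappa * (a * W) <= tau * q)%N by exact: leq_trunc_div.
have klow : (tau * q <= 2 * kappa * (a * W))%N.
  have := ltn_ceil (tau * q) aW0; rewrite -/kappa mulSn.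
  have : (1 * (a * W) <= kappa * (a * W))%N by rewrite leq_mul2r k0 orbT.
  by rewrite -mulnA; set u := (kappa * _)%N; lia.
have := le_trans (_ : (tau * q)%:R <= _) (total_richness Q k0).
rewrite ler_nat => /(_ low); rewrite -/q => H.
have main : (kappa ^ 2 * (tau * q) <= 32 * c ^ 2 * q ^ 2 * T)%N.
  have k2 : 0 < kappa%:R ^+ 2 :> R by rewrite exprn_gt0 ?ltr0n.
  move: H; rewrite -(ler_pM2r k2) mulrDl divfK ?gt_eqF // -natrX -!natrM -natrD ler_nat.
  have : (4 * (M * q + 45 * c * kappa * W) <= 3 * (tau * q))%N.
    have : (2 * M * q <= tau * q)%N by rewrite leq_mul2r tM orbT.
    by move: kup; rewrite /a; nia.
  move=> h1 h2; have : (kappa ^ 2 * (4 * (M * q + 45 * c * kappa * W)) <= kappa ^ 2 * (3 * (tau * q)))%N by rewrite leq_mul2l h1 orbT.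
  by move: h2; lia.
have [->|q0] := posnP q; first by rewrite muln0.
have : (tau ^ 2 * (tau * q) * q ^ 2 <= 128 * c ^ 2 * a ^ 2 * (W * E) * q ^ 2)%N.
  apply: (@leq_trans ((2 * kappa * (a * W)) ^ 2 * (tau * q))%N).
    rewrite -mulnA (mulnC _ (q ^ 2)%N) mulnA -expnMn leq_mul2r leq_exp2r ?klow ?orbT //.
  apply: (@leq_trans (4 * (a * W) ^ 2 * (32 * c ^ 2 * q ^ 2 * T))%N).
    have -> : ((2 * kappa * (a * W)) ^ 2 * (tau * q) = 4 * (a * W) ^ 2 * (kappa ^ 2 * (tau * q)))%N by ring.
    by rewrite leq_mul2l main orbT.
  apply: (@leq_trans (128 * c ^ 2 * a ^ 2 * (W * (T * W)) * q ^ 2)%N).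
    by rewrite eq_leq //; ring.
  by rewrite leq_mul2r !leq_mul2l TW !orbT.
rewrite leq_pmul2r ?expn_gt0 ?q0 // => h.
rewrite /rich_constant; move: h; rewrite (_ : tau ^ 2 * _ = tau ^ 3 * q)%N; last by ring.
nia.
Qed.

(** Levels up to k0 contribute at most k0 times the first moment.  Above k0, sum the
    bound of [card_rich] for the number of points of richness at least tau, with
    weight 2 * tau, over tau from k0 + 1 to the largest value M'. *)
Lemma second_moment_step (Q : {fset G}) (M' k0 : nat) :
  (forall n, n \in Q -> (richness n <= M')%N) -> (2 * M <= k0)%N -> (0 < k0)%N ->
  (\sum_(n <- Q) richness n * richness n)%:R <=
    (k0 * \sum_(n <- Q) richness n)%:R
    + (4 * rich_constant * W * E)%:R / k0%:R + (2 * rich_constant * W * M')%:R :> R.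
Proof.
move=> rM' k0M k00; pose tau t := (k0 + 1 + t)%N.
pose Qt t := [fset n in Q | (tau t <= richness n)%N]%fset.
have split_squares : (\sum_(n <- Q) richness n * richness n <=
    k0 * (\sum_(n <- Q) richness n) + \sum_(t < M') 2 * tau t * #|` Qt t|)%N.
  apply: (@leq_trans (\sum_(n <- Q) (k0 * richness n +
     \sum_(t < M') (tau t <= richness n) * (2 * tau t)))%N).
    rewrite big_seq [leqRHS]big_seq; apply: leq_sum => n nQ.
    by apply: square_le_tail_sum; apply: leq_trans (rM' n nQ) (leq_addl _ _).
  rewrite big_split /= -big_distrr /= leq_add2l exchange_big /=.
  apply: leq_sum => t _; rewrite card_fset_sum1 big_fset [in leqRHS]big_mkcond /= big_distrr /=.
  by apply: leq_sum => n _; case: (tau t <= richness n)%N; rewrite ?mul1n ?muln1 ?muln0.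
apply: le_trans (_ : _ <= (k0 * (\sum_(n <- Q) richness n) + \sum_(t < M') 2 * tau t * #|` Qt t|)%:R) _.
  by rewrite ler_nat.
rewrite natrD -[leRHS]addrA lerD2l natr_sum.
have term t : (2 * tau t * #|` Qt t|)%:R <=
    (2 * rich_constant * W * E)%:R * ((k0 + 1 + t)%:R ^+ 2)^-1 + (2 * rich_constant * W)%:R :> R.
  have tau0 : (0 < tau t)%N by rewrite /tau addn1.
  have k2 : 0 < (tau t)%:R ^+ 2 :> R by rewrite exprn_gt0 ?ltr0n.
  rewrite -(ler_pM2r k2) mulrDl divfK ?gt_eqF // -natrX -!natrM -natrD ler_nat.
  have := @card_rich (Qt t) (tau t) tau0 _ _.
  have -> : (2 * M <= tau t)%N by rewrite /tau; lia.
  move=> /(_ isT) H; have {}H := H _.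
  have {}H : (tau t ^ 3 * #|` Qt t| <= rich_constant * (W * (E + tau t ^ 2)))%N.
    by apply: H => n; rewrite !finmap.inE => /andP[].
  apply: (@leq_trans (2 * (tau t ^ 3 * #|` Qt t|))%N); first by rewrite eq_leq //; ring.
  by apply: leq_trans (leq_mul (leqnn 2) H) _; rewrite eq_leq //; ring.
apply: le_trans (ler_sum (index_enum 'I_M') (fun t (_ : predT t) => term t)) _.
rewrite big_split /= -mulr_sumr sumr_const card_ord -mulrnA; apply: lerD; last by [].
have := sum_inv_squares R M' (_ : 0 < k0 + 1)%N; rewrite addn1 => /(_ isT) h.
apply: le_trans (ler_wpM2l _ h) _; first by rewrite ler0n.
rewrite [leLHS]mulrA -[X in _ * X / _]/(2%:R) -natrM.
rewrite (_ : (2 * rich_constant * W * E * 2 = 4 * rich_constant * W * E)%N); last by ring.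
by rewrite ler_wpM2l ?ler0n // lef_pV2 ?posrE ?ltr0n // ler_nat.
Qed.
End RichTranslates.

(** * Numbers of representations *)

Section Representations.
Variables (R : realType) (psi : R -> R) (A : {fset R}).

Definition graph_point (a : R) : R * R := (a, psi a).
Definition vector_sum s (x : {ffun 'I_s -> A}) : R * R := \sum_i graph_point (val (x i)).
Definition reps s (n : R * R) := #|[set x : {ffun 'I_s -> A} | vector_sum x == n]|.
Definition sums s : {fset R * R} := [fset vector_sum x | x in {: {ffun 'I_s -> A}}]%fset.
Definition second_moment s := (\sum_(n <- sums s) reps s n * reps s n)%N.
(** The incidence n in m + Gamma, where Gamma is the graph of psi over A. *)
Definition on_translate (m n : R * R) := ((n - m).1 \in A) && ((n - m).2 == psi (n - m).1).

(** Sums over distinct points weighted by [reps] are sums over tuples. *)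
Lemma sum_reps s (F : R * R -> nat) :
  (\sum_(n <- sums s) reps s n * F n = \sum_(x : {ffun 'I_s -> A}) F (vector_sum x))%N.
Proof.
transitivity (\sum_(n <- sums s) \sum_(x : {ffun 'I_s -> A}) (vector_sum x == n) * F n)%N.
  apply: eq_bigr => n _; rewrite -big_distrl /=; congr (_ * _)%N.
  by rewrite /reps -sum1_card big_mkcond; apply: eq_bigr => x _; rewrite inE; case: (_ == _).
rewrite exchange_big; apply: eq_bigr => x _ /=.
have xs : vector_sum x \in sums s by apply/imfsetP; exists x.
rewrite (big_fsetD1 _ xs) /= eqxx mul1n big_seq big1 ?addn0 // => n.
by rewrite in_fsetD1 eq_sym => /andP[/negbTE-> _].
Qed.

Lemma total_reps s : (\sum_(n <- sums s) reps s n)%N = (#|` A| ^ s)%N.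
Proof.
transitivity (\sum_(n <- sums s) reps s n * 1)%N; first by apply: eq_bigr => n _; rewrite muln1.
by rewrite sum_reps sum1_card card_ffun card_ord cardfE.
Qed.

(** Split off the first summand: it is determined by the other ones and the sum. *)
Lemma reps_recursion s n : reps s.+1 n = richness on_translate (sums s) (reps s) n.
Proof.
rewrite /richness sum_reps /reps.
pose tail (y : {ffun 'I_s.+1 -> A}) : {ffun 'I_s -> A} := [ffun i => y (lift ord0 i)].
have split_sum y : vector_sum y = graph_point (val (y ord0)) + vector_sum (tail y).
  by rewrite /vector_sum big_ord_recl; congr (_ + _); apply: eq_bigr => i _; rewrite ffunE.
have -> : (\sum_(x : {ffun 'I_s -> A}) on_translate (vector_sum x) n =
    #|[set x : {ffun 'I_s -> A} | on_translate (vector_sum x) n]|)%N.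
  by rewrite -sum1_card [RHS]big_mkcond; apply: eq_bigr => x _; rewrite inE; case: (on_translate _ _).
rewrite -(@card_in_imset _ _ tail [set y | vector_sum y == n]) => [|y z].
  apply: eq_card => x; rewrite inE; apply/imsetP/idP => [[y]|/andP[d1 /eqP d2]].
    rewrite inE => /eqP <- ->; rewrite /on_translate split_sum addrK /=.
    by rewrite fsvalP eqxx.
  pose y : {ffun 'I_s.+1 -> A} := [ffun i => if unlift ord0 i is Some j then x j else [` d1]%fset].
  have ty : tail y = x by apply/ffunP => i; rewrite !ffunE liftK.
  have y0 : graph_point (val (y ord0)) = n - vector_sum x.
    by rewrite [RHS]surjective_pairing d2 ffunE unlift_none.
  by exists y => //; rewrite inE split_sum ty y0 subrK.
rewrite !inE => /eqP yn /eqP zn tE; move: yn; rewrite -zn !split_sum tE => /addIr[/val_inj y0 _].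
apply/ffunP => i; have [j ->|->] := unliftP ord0 i; last by [].
by have := congr1 (fun f : {ffun 'I_s -> A} => f j) tE; rewrite !ffunE.
Qed.

Lemma reps_step s n B : (forall m, (reps s m <= B)%N) -> (reps s.+1 n <= B * #|` A|)%N.
Proof.
move=> bound; rewrite reps_recursion /richness.
apply: (@leq_trans (\sum_(m <- sums s) B * on_translate m n)%N).
  by apply: leq_sum => m _; rewrite leq_mul2r bound orbT.
rewrite -big_distrr leq_mul2l /=; apply/orP; right.
have -> : (\sum_(m <- sums s) on_translate m n = size [seq (n - m)%R.1 | m <- sums s & on_translate m n])%N.
  rewrite size_map size_filter -sum1_count [RHS]big_mkcond; apply: eq_bigr => m _.
  by case: (on_translate m n).
apply: uniq_leq_size => [|a /mapP[m]]; last by rewrite mem_filter => /andP[/andP[mA _] _] ->.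
rewrite map_inj_in_uniq ?filter_uniq ?fset_uniq // => m m'.
rewrite !mem_filter => /andP[/andP[_ /eqP m2] _] /andP[/andP[_ /eqP m2'] _] E1.
have : n - m = n - m' by rewrite [LHS]surjective_pairing [RHS]surjective_pairing m2 m2' E1.
by move/addrI/oppr_inj.
Qed.

(** The two halves of a solution are tuples with the same sum. *)
Lemma energy_le_second_moment s : (energy psi s A <= second_moment s)%N.
Proof.
rewrite /second_moment sum_reps /reps.
under eq_bigr do rewrite -sum1_card.
rewrite pair_big_dep /= sum1_card /energy.
pose halves (x : {ffun 'I_(s + s) -> A}) : {ffun 'I_s -> A} * {ffun 'I_s -> A} :=
  ([ffun i => x (lshift s i)], [ffun i => x (rshift s i)]).
rewrite -(@card_imset _ _ halves) => [|x y [xl xr]]; last first.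
  apply/ffunP => i; rewrite -(fintype.splitK i); case: (fintype.split i) => j /=.
    by have := congr1 (fun f : {ffun 'I_s -> A} => f j) xl; rewrite !ffunE.
  by have := congr1 (fun f : {ffun 'I_s -> A} => f j) xr; rewrite !ffunE.
apply: subset_leq_card; apply/fintype.subsetP => _ /imsetP[x xE ->].
move: xE; rewrite inE !sumrB !subr_eq0 => /andP[/eqP E2 /eqP E1].
suff E : vector_sum (halves x).2 == vector_sum (halves x).1.
  by rewrite unfold_in /= -[X in is_true X]/(_ \in [set _ | _]) inE.
rewrite /vector_sum /=; under eq_bigr do rewrite ffunE; under [X in _ == X]eq_bigr do rewrite ffunE.
have pairE (F : 'I_s -> R) : \sum_i graph_point (F i) = (\sum_i F i, \sum_i psi (F i)).
  by elim/big_rec3: _ => // i u v w _ ->.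
by rewrite !pairE E1 E2.
Qed.
End Representations.

(** * The recursion on the number of summands *)

Section Energies.
Variables (R : realType) (I : interval R) (psi : R -> R) (C : R) (c : nat).
Hypothesis Cc : C <= c%:R.
Hypothesis c0 : (0 < c)%N.
Hypothesis psi_cont : {within [set` I], continuous psi}.
Hypothesis few_differences : forall d1 d2 : R, d1 != 0 -> card_at_most (diff_solutions I psi d1 d2) C.
Hypothesis few_sums : forall n1 n2 : R, card_at_most (sum_solutions I psi n1 n2) C.
Variable A : {fset R}.
Hypothesis AI : forall x, x \in A -> x \in I.
Hypothesis A0 : A != fset0.

Let N := #|` A|.
Let N0 : (0 < N)%N. Proof. by rewrite cardfs_gt0. Qed.

(** This is the condition on sums of two points. *)
Lemma reps_two n : (reps psi A 2 n <= c)%N.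
Proof.
rewrite /reps cardE -(size_map (fun x : {ffun 'I_2 -> A} => (val (x ord0), val (x ord_max)))).
have sumE (x : {ffun 'I_2 -> A}) :
    vector_sum psi x = graph_point psi (val (x ord0)) + graph_point psi (val (x ord_max)).
  by rewrite /vector_sum big_ord_recr big_ord1; congr (graph_point _ (val (x _)) + _); apply: val_inj.
apply: (card_at_most_size (few_sums n.1 n.2) Cc).
  rewrite map_inj_uniq ?enum_uniq // => x y [/val_inj x0 /val_inj x1].
  apply/ffunP => i; have [->|->] // : i = ord0 \/ i = ord_max.
  by case: i => -[|[|//]] h; [left|right]; apply: val_inj.
move=> xy /mapP[x]; rewrite mem_enum inE sumE => /eqP <- ->.
by split=> //=; apply: AI; apply: fsvalP.
Qed.

Lemma reps_le j n : (reps psi A j.+2 n <= c * N ^ j)%N.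
Proof.
elim: j n => [|j IH] n; first by rewrite muln1 reps_two.
by rewrite expnS mulnCA mulnC; apply: leq_trans (reps_step n IH) _; rewrite mulnC.
Qed.

Lemma translates_incidence_bound (P Q : {fset R * R}) k : (0 < k)%N ->
  (k ^ 2 * (\sum_(n <- Q) \sum_(m <- P) on_translate psi A m n) <=
   k ^ 2 * #|` Q| + c * (15 * k ^ 3 * #|` P| + c * #|` Q| ^ 2))%N.
Proof.
move=> k0; apply: leq_trans (incidences_of_translates Cc psi_cont few_differences P Q k0).
rewrite leq_mul2l; apply/orP; right; apply: leq_sum => n _; apply: leq_sum => m _.
rewrite /on_translate /on_graph; case: (boolP (_ \in A)) => // dA.
by rewrite (AI dA).
Qed.

(* D is chosen so that D ^ 2 = 4 c D + 2 c3 D + 2 c3 c D; these are the three terms of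
   the recursion for the constant K = D ^ 2. *)
Let c3 := rich_constant c.
Let D := (4 * c + 2 * c3 + 2 * c3 * c)%N.

Lemma second_moment_recursion j k0 : (2 * (c * N ^ j) <= k0)%N -> (0 < k0)%N ->
  (second_moment psi A j.+3)%:R <= (k0 * N ^ j.+3)%:R
    + (4 * c3 * N ^ j.+2 * second_moment psi A j.+2)%:R / k0%:R
    + (2 * c3 * N ^ j.+2 * (c * N ^ j.+1))%:R :> R.
Proof.
move=> k0M k00.
have W0 : (0 < \sum_(m <- sums psi A j.+2) reps psi A j.+2 m)%N by rewrite total_reps expn_gt0 N0.
have := second_moment_step R c0 translates_incidence_bound (reps_le j) W0
  (Q := sums psi A j.+3) (M' := (c * N ^ j.+1)%N) _ k0M k00.
rewrite -/c3 total_reps.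
have -> : (\sum_(n <- sums psi A j.+3) richness (on_translate psi A) (sums psi A j.+2) (reps psi A j.+2) n)%N
    = (N ^ j.+3)%N.
  by under eq_bigr do rewrite -reps_recursion; rewrite total_reps.
rewrite /second_moment; under [in X in _ -> X]eq_bigr do rewrite !reps_recursion.
by apply=> n _; rewrite -reps_recursion reps_le.
Qed.

(** Here s = j + 2, and v = N ^ (2 ^ (2 - s)) enters through v ^ (2 ^ j) = N, which keeps
    the induction free of real exponents: the step replaces v by its square root.
    The constant D ^ 2 reproduces itself. *)
Lemma second_moment_bound j (v : R) : 1 <= v -> v ^+ (2 ^ j) = N%:R ->
  (second_moment psi A j.+2)%:R <= D%:R ^+ 2 * (N%:R ^+ (2 * j + 1) * v).
Proof.
have D1 : 1 <= D%:R :> R by rewrite ler1n /D; lia.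
have x1 : 1 <= N%:R :> R by rewrite ler1n.
elim: j v => [|j IH] v v1 vN.
  rewrite muln0 add0n expr1 in vN *; rewrite expr1 in vN; rewrite vN.
  apply: (@le_trans _ _ (c * N ^ 2)%:R).
    rewrite ler_nat -(total_reps psi) big_distrr /=; apply: leq_sum => n _.
    by rewrite leq_mul2r reps_two orbT.
  rewrite natrM natrX -expr2 ler_wpM2r ?exprn_ge0 ?ler0n //.
  apply: (@le_trans _ _ D%:R); first by rewrite ler_nat /D; lia.
  by rewrite expr2 ler_peMr // ler0n.
have e1 : (2 * j.+1 + 1 = j + j.+3)%N by lia.
have e2 : (2 * j.+1 + 1 + j = j.+2 + (2 * j + 1))%N by lia.
have e3 : (2 * j.+1 + 1 = j.+2 + j.+1)%N by lia.
have v2 : 1 <= v ^+ 2 by rewrite exprn_ege1.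
have vN2 : (v ^+ 2) ^+ (2 ^ j) = N%:R by rewrite -exprM -expnS.
have {}IH := IH _ v2 vN2; set x : R := N%:R in x1 IH vN *.
set F := second_moment psi A j.+2 in IH.
have x0 : 0 < x by lra.
have v0 : 0 < v by lra.
have xj : 0 < x ^+ j by rewrite exprn_gt0.
have xj1 : 1 <= x ^+ j by rewrite exprn_ege1.
have c1 : 1 <= c%:R :> R by rewrite ler1n.
(* y is (M_s / N)^(1/2) up to a constant: the value of k0 that balances the first two
   terms of the recursion, made large enough to exceed twice the bound c N^j for r_s *)
pose y : R := 2 * c%:R * D%:R * (x ^+ j * v).
have xv1 : 1 <= x ^+ j * v by rewrite mulr_ege1.
have y1 : 1 <= y by rewrite /y !mulr_ege1 // ler1n.
pose k0 := (Num.truncn y).+1.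
have [ky1 ky2] : y <= k0%:R /\ k0%:R <= 2 * y.
  have /andP[h1 h2] := truncn_itv (le_trans ler01 y1).
  by split; [exact: ltW | rewrite /k0 -natr1; lra].
have k0M : (2 * (c * N ^ j) <= k0)%N.
  rewrite -(ler_nat R); apply: le_trans ky1; rewrite !natrM natrX -/x /y -!mulrA ler_wpM2l ?ler0n //.
  rewrite ler_wpM2l ?ler0n // mulrCA ler_peMr ?mulr_ege1 // ltW //.
have k00 : (0 < k0)%N by [].
apply: le_trans (second_moment_recursion k0M k00) _; rewrite -/F.
set Z := x ^+ (2 * j.+1 + 1) * v.
have X0 i : 0 <= x ^+ i by rewrite exprn_ge0 // ltW.
have xE i i' : x ^+ i * x ^+ i' = x ^+ (i + i') by rewrite exprD.
have first_term : (k0 * N ^ j.+3)%:R <= 4 * c%:R * D%:R * Z.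
  rewrite natrM natrX -/x; apply: (@le_trans _ _ (2 * y * x ^+ j.+3)).
    by rewrite ler_wpM2r // exprn_ge0 // ltW.
  rewrite /Z /y.
  have -> : x ^+ (2 * j.+1 + 1) = x ^+ j * x ^+ j.+3 by rewrite xE e1.
  by rewrite le_eqVlt; apply/orP; left; apply/eqP; move: (x ^+ j) (x ^+ j.+3) => p q; ring.
have second_term : (4 * c3 * N ^ j.+2 * F)%:R / k0%:R <= 2 * c3%:R * D%:R * Z.
  apply: (@le_trans _ _ ((4 * c3 * N ^ j.+2)%:R * (D%:R ^+ 2 * (x ^+ (2 * j + 1) * v ^+ 2)) / y)).
    rewrite natrM; apply: ler_pM => //; rewrite ?mulr_ge0 ?ler0n ?invr_ge0 ?ler0n //.
      by rewrite ler_wpM2l ?ler0n.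
    by rewrite lef_pV2 // posrE ?ltr0n //; lra.
  rewrite ler_pdivrMr; last by lra.
  have -> : (4 * c3 * N ^ j.+2)%:R = 4%:R * c3%:R * x ^+ j.+2 :> R by rewrite natrM natrX natrM.
  have -> : 2 * c3%:R * D%:R * Z * y = c%:R * (4%:R * c3%:R * x ^+ j.+2 * (D%:R ^+ 2 * (x ^+ (2 * j + 1) * v ^+ 2))).
    rewrite /Z /y; have pows : x ^+ (2 * j.+1 + 1) * x ^+ j = x ^+ j.+2 * x ^+ (2 * j + 1).
      by rewrite !xE e2.
    move: pows; move: (x ^+ (2 * j.+1 + 1)) (x ^+ j) (x ^+ j.+2) (x ^+ (2 * j + 1)) => p q r t pows.
    by transitivity (4 * c3%:R * c%:R * D%:R ^+ 2 * v ^+ 2 * (p * q)); [ring|rewrite pows; ring].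
  rewrite ler_peMl //; apply: mulr_ge0 (mulr_ge0 _ (X0 _)) (mulr_ge0 (sqr_ge0 _) (mulr_ge0 (X0 _) (sqr_ge0 _))).
  by rewrite mulr_ge0 ?ler0n.
have third_term : (2 * c3 * N ^ j.+2 * (c * N ^ j.+1))%:R <= 2 * c3%:R * c%:R * D%:R * Z.
  rewrite natrM [X in X * _]natrM [X in _ * X]natrM !natrX natrM -/x.
  have -> : 2%:R * c3%:R * x ^+ j.+2 * (c%:R * x ^+ j.+1) = 2 * c3%:R * c%:R * x ^+ (2 * j.+1 + 1).
    have -> : x ^+ (2 * j.+1 + 1) = x ^+ j.+2 * x ^+ j.+1 by rewrite xE e3.
    by move: (x ^+ j.+2) (x ^+ j.+1) => p q; ring.
  rewrite /Z -!mulrA; do 3![rewrite ler_wpM2l ?ler0n //].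
  rewrite mulrCA ler_peMr ?exprn_ge0 ?(ltW x0) // mulr_ege1 //.
have -> : D%:R ^+ 2 * Z = 4 * c%:R * D%:R * Z + 2 * c3%:R * D%:R * Z + 2 * c3%:R * c%:R * D%:R * Z.
  have DE : D%:R = 4 * c%:R + 2 * c3%:R + 2 * c3%:R * c%:R :> R.
    by rewrite /D natrD natrD (natrM _ 4) (natrM _ (2 * c3)) (natrM _ 2).
  by transitivity (D%:R * (4 * c%:R + 2 * c3%:R + 2 * c3%:R * c%:R) * Z); [rewrite -DE expr2|ring].
by rewrite !lerD.
Qed.
End Energies.

Theorem theorem2p1 (R : realType) (C : R) (hC : 0 < C) :
  exists K : R, 0 < K /\
    forall (I : interval R) (psi : R -> R),
      {within [set` I], continuous psi} ->
      (forall d1 d2 : R, d1 != 0 -> card_at_most (diff_solutions I psi d1 d2) C) ->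
      (forall n1 n2 : R, card_at_most (sum_solutions I psi n1 n2) C) ->
      forall (A : {fset R}) (s : nat),
        A != fset0 ->
        (forall x : R, x \in A -> x \in I) ->
        (3 <= s)%N ->
        (energy psi s A)%:R <=
          K * ((#|` A|)%:R `^ (2 * s%:R - 3 + 2 `^ (- s%:R + 2))).
Proof.
pose c := (Num.truncn C).+1.
have Cc : C <= c%:R by apply: ltW; apply: truncnS_gt.
have c0 : (0 < c)%N by [].
pose D := (4 * c + 2 * rich_constant c + 2 * rich_constant c * c)%N.
exists (D%:R ^+ 2); split.
  by rewrite exprn_gt0 // ltr0n /D; lia.
move=> I psi cont diffs sums A s A0 AI s3.
have N0 : (0 < #|` A|)%N by rewrite cardfs_gt0.
pose j := (s - 2)%N; have sE : s = j.+2 by rewrite /j; lia.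
set x : R := (#|` A|)%:R; have x1 : 1 <= x by rewrite ler1n.
have x0 : 0 < x by lra.
pose v := x `^ ((2 ^+ j)^-1).
have v1 : 1 <= v by rewrite -(powRr0 x) /v ler_powR // invr_ge0 exprn_ge0.
have vN : v ^+ (2 ^ j) = x.
  rewrite -powR_mulrn ?(le_trans ler01) // /v -powRrM natrX mulVf ?powRr1 ?(ltW x0) //.
apply: (@le_trans _ _ (second_moment psi A s)%:R); first by rewrite ler_nat energy_le_second_moment.
rewrite sE; apply: le_trans (second_moment_bound Cc c0 cont diffs sums AI A0 v1 vN) _.
rewrite -/D ler_wpM2l ?exprn_ge0 ?ler0n // -/x /v.
have -> : (- j.+2%:R + 2 : R) = - j%:R by rewrite -[j.+2]/(2 + j)%N natrD; ring.
have -> : (2 * j.+2%:R - 3 : R) = (2 * j + 1)%:R.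
  by rewrite -[j.+2]/(2 + j)%N (natrD _ 2) natrD (natrM _ 2); ring.
rewrite powRN powR_mulrn // powRD ?powR_mulrn // ?(ltW x0) //.
by rewrite (gt_eqF x0) implybT.
Qed.
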